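(* Let $J_k(n)$ ($k\ge0$, $n\ge0$) be as in the context, and define the normalized numbers $\tilde J_k(n)$ inductively by $\tilde J_1(n)=J_1(n)$ and, for $s\ge1$, \[ J_{2s}(n)=\sum_{j=0}^{s-1}J_{2s-2j}(0)\,\tilde J_{2j+2}(n),\qquad J_{2s+1}(n)=\sum_{j=0}^{s-1}J_{2s+1-2j}(0)\,\tilde J_{2j+2}(n)+\tilde J_{2s+1}(n). \] Then for every integer $s\ge1$ and $n\ge0$, \[ \tilde J_{2s+2}(n)=\sum_{k=0}^n(-1)^k\binom{-\frac12}{k}^{2}\binom nk Z^{\mathrm{even}}_s(k),\qquad \tilde J_{2s+1}(n)=\sum_{k=0}^n(-1)^k\binom{-\frac12}{k}^{2}\binom nk Z^{\mathrm{odd}}_s(k). \]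
   Context: For $k\ge2$, $n\ge0$: $J_k(n)=\sum_{r=1}^{k-1}2^k\int_{[0,1]^k}\frac{(1-u_1^4\cdots u_r^4)^n(1-u_{r+1}^4\cdots u_k^4)^n}{(1-u_1^2\cdots u_k^2)^{2n+1}}du_1\cdots du_k$; $J_0(n)=0$; $J_1(n)=\frac{2^nn!}{(2n+1)!!}$. (One has $J_2(0)\neq0$, so the defining relations determine $\tilde J_k(n)$ inductively.) For $s\ge1$ and integers $k\ge0$: $Z^{\mathrm{even}}_s(k)=(-1)^s\sum_{k>j_1>\cdots>j_s\ge0}\frac{1}{(j_1+\frac12)^2\cdots(j_s+\frac12)^2}$, $Z^{\mathrm{odd}}_s(k)=\frac{(-1)^s}{2}\sum_{k>j_1>\cdots>j_s\ge0}\frac{1}{(j_1+\frac12)^2\cdots(j_{s-1}+\frac12)^2(j_s+\frac12)^3}\binom{-\frac12}{j_s}^{-2}$. *)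

(* Defs.v *)
From HB Require Import structures.
From mathcomp Require Import all_boot all_order all_algebra.
From mathcomp Require Import all_classical all_reals all_analysis.

Set Implicit Arguments.
Unset Strict Implicit.
Unset Printing Implicit Defensive.

Import Order.TTheory GRing.Theory Num.Theory.

Local Open Scope classical_set_scope.
Local Open Scope ring_scope.

Lemma sigma_finite_measureP d (T : measurableType d) (R : realType)
    (m : {measure set T -> \bar R}) : sigma_finite setT m ->
  exists m' : {sigma_finite_measure set T -> \bar R},
    m = m' :> (set T -> \bar R).
Proof.
case: m => m mc /= m_sfin.
pose m1 : {measure set T -> \bar R} := Measure.Pack mc.
pose mS := Measure_isSigmaFinite.Build _ _ _ m1 m_sfin.
pose m' : {sigma_finite_measure set T -> \bar R} := HB.pack m mc mS.
by exists m'.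
Qed.

Section lebesgue_tuple.
Context {R : realType}.
Local Notation rT := (measurableTypeR R).

Definition tcons k (p : rT * k.-tuple rT) : k.+1.-tuple rT :=
  [tuple of p.1 :: p.2].

(* The k-dimensional Lebesgue measure on the Borel sets of R^k, as the k-fold
   product of the one-dimensional one; see lebesgue_tuple_box. *)
Fixpoint lebesgue_tuple k : set (k.-tuple rT) -> \bar R :=
  match k with
  | 0 => dirac [tuple]
  | k'.+1 =>
      pushforward (product_measure1 (@lebesgue_measure R) (@lebesgue_tuple k'))
        (@tcons k')
  end.

Lemma measurable_tcons k : measurable_fun [set: rT * k.-tuple rT] (@tcons k).
Proof. exact: measurable_cons. Qed.

Lemma lebesgue_tuple_sigma_finite_measure k :
  exists m : {sigma_finite_measure set (k.-tuple rT) -> \bar R},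
    @lebesgue_tuple k = m.
Proof.
elim: k => [|k [m mE]]; first by exists (dirac ([tuple] : 0.-tuple rT)).
pose l : {sigma_finite_measure set rT -> \bar R} := @lebesgue_measure R.
pose M : {measure set (rT * k.-tuple rT) -> \bar R} := product_measure1 l m.
pose N := pushforward M (@tcons k).
have N_sfin : sigma_finite setT N.
  have [F FT FP] : sigma_finite setT M.
    have /sigma_finiteP[F [TF ndF Foo]] := sigma_finiteT l.
    have /sigma_finiteP[G [TG ndG Goo]] := sigma_finiteT m.
    exists (fun n => F n `*` G n).
      rewrite -setXTT TF TG predeqE => -[x y]; split.
        move=> [/= [i _ Fx] [j _ Gy]]; exists (maxn i j) => //; split.
        - by move: x Fx; exact/subsetPset/ndF/leq_maxl.
        - by move: y Gy; exact/subsetPset/ndG/leq_maxr.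
      by move=> [n _ []/= ? ?]; split; exists n.
    move=> n; have [? ?] := Foo n; have [? ?] := Goo n.
    split; first exact: measurableX.
    by rewrite /M/= product_measure1E// lte_mul_pinfty// ge0_fin_numE.
  pose tl (t : k.+1.-tuple rT) : k.-tuple rT := [tuple of behead t].
  pose un (t : k.+1.-tuple rT) := (tnth t ord0, tl t).
  have mun : measurable_fun setT un.
    by apply/measurable_fun_pair; [exact: measurable_tnth|exact: measurable_behead].
  have unK p : un (tcons p) = p.
    by case: p => x t; congr pair; exact: val_inj.
  exists (fun n => un @^-1` F n).
    by rewrite -preimage_bigcup -FT preimage_setT.
  move=> n; have [mF Foo] := FP n; split.
    by rewrite -[X in measurable X]setTI; exact: mun.
  rewrite /N /pushforward -comp_preimage.
  suff -> : un \o @tcons k = id by [].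
  exact/funext/unK.
have [N' N'E] := sigma_finite_measureP
  (m := measure_function_pushforward__canonical__measure_function_Measure
    M (@measurable_tcons k)) N_sfin.
by exists N'; rewrite -N'E /= mE.
Qed.

Lemma lebesgue_tuple0 k : @lebesgue_tuple k set0 = 0%E.
Proof. by have [m ->] := lebesgue_tuple_sigma_finite_measure k. Qed.

Lemma lebesgue_tuple_ge0 k A : (0 <= @lebesgue_tuple k A)%E.
Proof. by have [m ->] := lebesgue_tuple_sigma_finite_measure k. Qed.

Lemma lebesgue_tuple_sigma_additive k :
  semi_sigma_additive (@lebesgue_tuple k).
Proof.
have [m ->] := lebesgue_tuple_sigma_finite_measure k.
exact: measure_semi_sigma_additive.
Qed.

HB.instance Definition _ k := isMeasure.Build _ _ _ (@lebesgue_tuple k)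
  (@lebesgue_tuple0 k) (@lebesgue_tuple_ge0 k)
  (@lebesgue_tuple_sigma_additive k).

Lemma lebesgue_tuple_sigma_finite k : sigma_finite setT (@lebesgue_tuple k).
Proof.
have [m ->] := lebesgue_tuple_sigma_finite_measure k.
exact: sigma_finiteT.
Qed.

HB.instance Definition _ k := Measure_isSigmaFinite.Build _ _ _
  (@lebesgue_tuple k) (@lebesgue_tuple_sigma_finite k).

Lemma lebesgue_tuple_box k (A : 'I_k -> set rT) :
  (forall i, measurable (A i)) ->
  lebesgue_tuple [set t : k.-tuple rT | forall i, A i (tnth t i)] =
  (\prod_(i < k) lebesgue_measure (A i))%E.
Proof.
elim: k A => [|k IH] A mA.
  rewrite big_ord0 /= diracE mem_set//= => -[].
  by [].
rewrite big_ord_recl -IH => [|i]; last exact: mA.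
rewrite -product_measure1E//; last first.
  rewrite (_ : [set _ | _] =
      \bigcap_(i in [set: 'I_k]) ((@tnth k rT)^~ i @^-1` A (lift ord0 i))).
    apply: fin_bigcap_measurable => // i _.
    by rewrite -[X in measurable X]setTI; exact: measurable_tnth.
  by apply/seteqP; split => t /= tA i => [_|]; exact: tA.
rewrite /= /pushforward; congr (product_measure1 _ _ _).
apply/seteqP; split => -[x t] /=.
  move=> xt; split; first exact: (xt ord0).
  by move=> i; have := xt (lift ord0 i); rewrite tnthS.
move=> [Ax At] i; case: (unliftP ord0 i) => [j ->|->]//.
by rewrite tnthS.
Qed.

End lebesgue_tuple.
Arguments lebesgue_tuple R k : clear implicits.

Section statement_objects.
Context (R : realType).

Definition unit_cube k : set (k.-tuple (measurableTypeR R)) :=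
  [set u | forall i : 'I_k, 0 <= tnth u i <= 1].
Arguments unit_cube k : clear implicits.

(* the variables u_1, ..., u_k are the coordinates 0, ..., k - 1 of u *)
Definition J_integrand (k r n : nat) (u : k.-tuple (measurableTypeR R)) : R :=
  (1 - \prod_(i < k | (i < r)%N) tnth u i ^+ 4) ^+ n *
  (1 - \prod_(i < k | (r <= i)%N) tnth u i ^+ 4) ^+ n /
  (1 - \prod_(i < k) tnth u i ^+ 2) ^+ (2 * n + 1).

Definition odd_double_factorial (n : nat) : nat :=
  (\prod_(i < n.+1) (2 * i + 1))%N.

Definition J (k n : nat) : R :=
  match k with
  | 0 => 0
  | 1 => (2 ^ n * n`!)%:R / (odd_double_factorial n)%:R
  | _ => \sum_(1 <= r < k) 2 ^+ k *
           \int[lebesgue_tuple R k]_(u in unit_cube k) J_integrand r n u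
  end.

(* Jt is the family of normalized numbers: the relations determine Jt k n for
   all k >= 1 since J 2 0 != 0; the value at k = 0 is irrelevant. *)
Definition normalized_J (Jt : nat -> nat -> R) : Prop :=
  [/\ forall n, Jt 1%N n = J 1 n,
      forall s n, (1 <= s)%N ->
        J (2 * s) n =
        \sum_(0 <= j < s) J (2 * s - 2 * j) 0 * Jt (2 * j + 2)%N n
    & forall s n, (1 <= s)%N ->
        J (2 * s + 1) n =
        \sum_(0 <= j < s) J (2 * s + 1 - 2 * j) 0 * Jt (2 * j + 2)%N n
        + Jt (2 * s + 1)%N n].

Definition gbinom (a : R) (k : nat) : R :=
  (\prod_(i < k) (a - i%:R)) / k`!%:R.

(* k > j_1 > ... > j_s >= 0, where j_(i + 1) is component i of j *)
Definition decreasing_tuple (s k : nat) (j : s.-tuple 'I_k) : bool :=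
  [forall a : 'I_s, forall b : 'I_s, (a < b)%N ==> (tnth j b < tnth j a)%N].

Definition Z_even (s k : nat) : R :=
  (-1) ^+ s *
  \sum_(j : s.-tuple 'I_k | decreasing_tuple j)
    \prod_(i < s) ((tnth j i)%:R + 1 / 2) ^- 2.

Definition Z_odd (s k : nat) : R :=
  (-1) ^+ s / 2 *
  \sum_(j : s.-tuple 'I_k | decreasing_tuple j)
    \prod_(i < s)
      (if (i.+1 < s)%N then ((tnth j i)%:R + 1 / 2) ^- 2
       else ((tnth j i)%:R + 1 / 2) ^- 3 * gbinom (- (1 / 2)) (tnth j i) ^- 2).

End statement_objects.

(* Main.v *)
Require Import Defs.
From mathcomp Require Import all_boot all_order all_algebra.
From mathcomp Require Import all_classical all_reals all_analysis.
From mathcomp Require Import measurable_realfun.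
From mathcomp Require Import ring lra zify.

(* Write x and y for the products of the first r and of the last k - r
   variables.  Since (1 - x^4)(1 - y^4) = (1 - x^2y^2)^2 - (x^2 - y^2)^2, the
   binomial theorem gives J_k(n) = sum_m (-1)^m binom(n,m) B_k(m), where B_k(m)
   is 2^k times the sum over r of the integrals of
   (x^2 - y^2)^(2m) / (1 - x^2y^2)^(2m+1).

   Expanding 1/(1 - z)^(2m+1) in powers of z, once at z = x^2y^2 and once at
   z = exp(-2p), and integrating term by term identifies, for k >= 2,
     B_k(m) = 2^(k-1)/(k-2)! int_0^oo p^(k-2) F_m(p) dp,
     F_m(p) = sinh(p)^-(2m+1) int_0^p sinh(q)^(2m) dq.
   The equation F_m'' = (2m+1)^2 F_m - (2m+2)^2 F_(m+1) and two integrations by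
   parts then give
     (m+1)^2 B_k(m+1) = (m+1/2)^2 B_k(m) - B_(k-2)(m),
   with B_0 = 0 and B_1(m) = 1/(2m+1) as boundary terms.  After division by
   binom(-1/2,m)^2 this is the recursion in k of Z^even_s(k) and Z^odd_s(k). *)

Set Implicit Arguments.
Unset Strict Implicit.
Unset Printing Implicit Defensive.

Import Order.TTheory GRing.Theory Num.Theory.
Import numFieldNormedType.Exports.

Local Open Scope ring_scope.

(** * Sums over decreasing tuples and the recurrence for J *)

(** The shape of F_m comes from a substitution. Put a = -log x, b = -log y, p = a + b and t = b - a.
    Then x^2 - y^2 = 2 exp(-p) sinh t and 1 - x^2y^2 = 2 exp(-p) sinh p. The densities a^(r-1)
    b^(k-r-1) / ((r-1)! (k-r-1)!) sum over r to p^(k-2) / (k-2)!, and t runs through [-p, p].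
    Summing over r is thus what leaves a one-dimensional integral. No such change of variables is
    carried out in k dimensions. Both sides are expanded with the same negative binomial
    coefficients, and the rational numbers that the terms integrate to are compared. Since the power
    2m is even, all terms of both series are nonnegative, so monotone convergence justifies every
    exchange and finiteness of the cube integrals comes out as a consequence. The recursion for
    B_k(m) determines it from the initial values B_k(0) and the boundary values B_0, B_1. The
    solution has the same convolution shape as the relations defining the normalized numbers, and
    the binomial transform from B to J preserves that shape. *)

Section decreasing_sums.
Context {R : realType}.

(** Peeling off the largest index first means that raising [k] by one adds a single term to the
    outermost sum. Lists let the summand keep one type while indices are prepended. *)
Fixpoint decr_sum (s k : nat) (f : seq nat -> R) : R :=
  if s is s'.+1 then \sum_(0 <= x < k) decr_sum s' x (fun l => f (x :: l))
  else f [::].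

Lemma decr_sum_recr s k f :
  decr_sum s.+1 k.+1 f =
  decr_sum s.+1 k f + decr_sum s k (fun l => f (k :: l)).
Proof. by rewrite /= big_nat_recr. Qed.

Lemma decr_sumS0 s f : decr_sum s.+1 0 f = 0.
Proof. by rewrite /= big_nil. Qed.

Lemma eq_decr_sum s k f g : (forall l, size l = s -> f l = g l) ->
  decr_sum s k f = decr_sum s k g.
Proof.
elim: s k f g => [|s ih] k f g fg /=; first exact: fg.
by apply: eq_bigr => x _; apply: ih => l ls; apply: fg; rewrite /= ls.
Qed.

Lemma decr_sumZ s k c f : decr_sum s k (fun l => c * f l) = c * decr_sum s k f.
Proof.
elim: s k f => [|s ih] k f //=.
by rewrite big_distrr /=; apply: eq_bigr => x _; rewrite ih.
Qed.

Lemma decreasing_tuple_cons s k (x : 'I_k) (t : s.-tuple 'I_k) :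
  decreasing_tuple [tuple of x :: t] =
  all (fun y : 'I_k => (y < x)%N) t && decreasing_tuple t.
Proof.
apply/forallP/andP => [H|[/all_tnthP Hx /forallP Ht] a].
  split.
    apply/all_tnthP => i; have /forallP/(_ (lift ord0 i)) := H ord0.
    by rewrite tnth0 tnthS.
  apply/forallP => a; apply/forallP => b; apply/implyP => ab.
  have /forallP/(_ (lift ord0 b))/implyP := H (lift ord0 a).
  by rewrite !tnthS; apply.
apply/forallP => b; apply/implyP.
case: (unliftP ord0 b) => [b' ->|->//].
case: (unliftP ord0 a) => [a' ->|->]; last by rewrite tnth0 tnthS.
rewrite !tnthS !lift0 ltnS => ab.
by have /forallP/(_ b')/implyP := Ht a'; apply.
Qed.

Lemma big_tuple_cons s (T : finType) (P : pred (s.+1.-tuple T))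
    (f : s.+1.-tuple T -> R) :
  \sum_(j : s.+1.-tuple T | P j) f j =
  \sum_(x : T) \sum_(t : s.-tuple T | P [tuple of x :: t]) f [tuple of x :: t].
Proof.
rewrite pair_big_dep /=.
rewrite (reindex (fun p : T * s.-tuple T => [tuple of p.1 :: p.2])) //=.
exists (fun t : s.+1.-tuple T => (thead t, [tuple of behead t])).
  by move=> [x t] _ /=; congr pair; apply: val_inj.
by move=> t _; rewrite -tuple_eta.
Qed.

(** The type ['I_K] stays fixed while the bound [k] varies, because the induction replaces [k] by
    the first entry of the tuple. *)
Lemma big_decreasing_tuple_lt s K k (f : seq nat -> R) : (k <= K)%N ->
  \sum_(t : s.-tuple 'I_K | decreasing_tuple t &&
      all (fun y : 'I_K => (y < k)%N) t) f (map val t) =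
  decr_sum s k f.
Proof.
elim: s k f => [|s ih] k f kK.
  rewrite (big_pred1 [tuple]) //= => t; rewrite (tuple0 t) /= andbT.
  by rewrite [RHS]eqxx; apply/forallP => -[].
rewrite big_tuple_cons /= (big_nat_widen _ _ _ _ _ kK) big_mkord.
rewrite [RHS]big_mkcond /=; apply: eq_bigr => x _.
case: ifPn => [xk|xk]; last first.
  by rewrite big_pred0 // => t; rewrite andbF.
rewrite -(ih x (fun l => f ((x : nat) :: l)) (ltnW (ltn_ord x))).
apply: eq_bigl => t; rewrite decreasing_tuple_cons /=.
case tx: (all (fun y : 'I_K => (y < x)%N) t); last by rewrite andbF /=.
rewrite (_ : all _ t = true) ?andbT //.
by apply: sub_all tx => y yx; exact: ltn_trans yx xk.
Qed.

Lemma big_decreasing_tuple s k (f : seq nat -> R) :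
  \sum_(t : s.-tuple 'I_k | decreasing_tuple t) f (map val t) = decr_sum s k f.
Proof.
rewrite -(@big_decreasing_tuple_lt s k k f (leqnn k)); apply: eq_bigl => t.
by rewrite andb_idr // => _; apply/allP => y _; exact: ltn_ord.
Qed.

End decreasing_sums.

(** * From the recurrence for B to the formulas for the normalized numbers *)

Section normalized.
Context {R : realType}.
Implicit Types (k m n s : nat).

Let w m : R := (m%:R + 1 / 2) ^- 2.
Let v m : R := (m%:R + 1 / 2) ^- 3 * gbinom (- (1 / 2)) m ^- 2.
Let A m : R := gbinom (- (1 / 2)) m ^+ 2.

Lemma half_neq0 m : m%:R + 1 / 2 != 0 :> R.
Proof. by rewrite gt_eqF // ltr_wpDl // ?ler0n // divr_gt0. Qed.

Lemma gbinomS (a : R) k : gbinom a k.+1 * k.+1%:R = gbinom a k * (a - k%:R).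
Proof.
rewrite /gbinom big_ord_recr /= factS natrM.
have k1 : k.+1%:R != 0 :> R by rewrite pnatr_eq0.
have kf : k`!%:R != 0 :> R by rewrite pnatr_eq0 -lt0n fact_gt0.
by move: k.+1%:R k1 => c c0; field; rewrite kf c0.
Qed.

(** The factor -1/2 - m from [gbinomS] loses its sign when squared. This identity makes [A] absorb
    both quadratic coefficients of the recurrence for B. *)
Lemma gbinom_half_sqrS m :
  m.+1%:R ^+ 2 * A m.+1 = (m%:R + 1 / 2) ^+ 2 * A m.
Proof.
rewrite /A -!exprMn [_ * gbinom _ m.+1]mulrC gbinomS -sqrrN; congr (_ ^+ 2); ring.
Qed.

Lemma gbinom_half_sqr0 : A 0 = 1.
Proof. by rewrite /A /gbinom big_ord0 fact0 divr1 expr1n. Qed.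

Lemma gbinom_half_sqr_neq0 m : A m != 0.
Proof.
elim: m => [|m ih]; first by rewrite gbinom_half_sqr0 oner_neq0.
apply/eqP => Am; have := gbinom_half_sqrS m; rewrite Am mulr0 => /esym/eqP.
by rewrite mulf_eq0 (negbTE ih) orbF expf_eq0 /= (negbTE (half_neq0 m)).
Qed.

Lemma Z_evenE s k :
  Z_even R s k = (-1) ^+ s * decr_sum s k (fun l => \prod_(x <- l) w x).
Proof.
rewrite /Z_even; congr (_ * _).
rewrite -big_decreasing_tuple; apply: eq_bigr => t _.
by rewrite big_map big_tuple.
Qed.

Lemma Z_even0 k : Z_even R 0 k = 1.
Proof. by rewrite Z_evenE /= big_nil mulr1. Qed.

Lemma Z_evenS0 s : Z_even R s.+1 0 = 0.
Proof. by rewrite Z_evenE decr_sumS0 mulr0. Qed.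

Lemma Z_evenS s k : Z_even R s.+1 k.+1 = Z_even R s.+1 k - w k * Z_even R s k.
Proof.
rewrite !Z_evenE decr_sum_recr mulrDr; congr (_ + _).
under eq_decr_sum do rewrite big_cons.
by rewrite decr_sumZ exprS; ring.
Qed.

(** The weight depends on position, the last index being special. The default of [nth] is never
    read, as the lists that occur have length [s]. *)
Let odd_weight (s : nat) (l : seq nat) : R :=
  \prod_(i < s) (if (i.+1 < s)%N then w (nth 0%N l i) else v (nth 0%N l i)).

Lemma Z_oddE s k :
  Z_odd R s k = (-1) ^+ s / 2 * decr_sum s k (odd_weight s).
Proof.
rewrite /Z_odd; congr (_ * _).
rewrite -big_decreasing_tuple; apply: eq_bigr => t _.
apply: eq_bigr => i _.
have -> : nth 0%N (map val t) i = tnth t i.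
  by rewrite (nth_map (tnth t i)) ?size_tuple// -tnth_nth.
by [].
Qed.

Lemma Z_oddS0 s : Z_odd R s.+1 0 = 0.
Proof. by rewrite Z_oddE decr_sumS0 mulr0. Qed.

(** The weight of the single index is [v k / 2], and (k + 1/2)^-1 / 2 = 1/(2k+1); hence [v k / 2] is
    [w k] divided by (2k+1) [A k]. *)
Lemma Z_odd1S k :
  Z_odd R 1 k.+1 = Z_odd R 1 k - w k * ((2 * k%:R + 1) * A k)^-1.
Proof.
rewrite !Z_oddE decr_sum_recr mulrDr; congr (_ + _).
rewrite /odd_weight /= big_ord1 /= /v /w /A expr1.
have := half_neq0 k; have := gbinom_half_sqr_neq0 k; rewrite /A expf_eq0 /= => h1 h2.
have h3 : 2 * k%:R + 1 != 0 :> R.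
  by have := half_neq0 k; apply: contra => /eqP h; apply/eqP; lra.
by field; rewrite h1 h3.
Qed.

Lemma Z_oddSS s k :
  Z_odd R s.+2 k.+1 = Z_odd R s.+2 k - w k * Z_odd R s.+1 k.
Proof.
rewrite !Z_oddE decr_sum_recr mulrDr; congr (_ + _).
(* Prepending an index leaves the last position last, and the new first index has the ordinary
   weight since there are at least two. *)
rewrite (@eq_decr_sum _ _ _ _ (fun l => w k * odd_weight s.+1 l)); last first.
  by move=> l _; rewrite /odd_weight big_ord_recl.
by rewrite decr_sumZ [in LHS]exprS; field.
Qed.

(** The value at [s = 0] is chosen so that [Z_odd1S] becomes the case s = 0 of the recursion
    [Z_oddSS], and so that [A m * z_odd 0 m] is B_1(m). *)
Let z_odd s m : R :=
  if s is 0 then ((2 * m%:R + 1) * A m)^-1 else Z_odd R s m.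

(** After division by [A], the recurrence in [m] is that of the Z sums. The terms with [Z_even]
    carry the initial values at [m = 0], since [Z_even 0] is 1 and the others vanish there; [z]
    carries the boundary values [C 0]. *)
Lemma recurrence_solution (C z : nat -> nat -> R) :
  (forall m, C 0%N m = A m * z 0%N m) ->
  (forall s, z s.+1 0%N = 0) ->
  (forall s m, z s.+1 m.+1 = z s.+1 m - w m * z s m) ->
  (forall s m, m.+1%:R ^+ 2 * C s.+1 m.+1 =
               (m%:R + 1 / 2) ^+ 2 * C s.+1 m - C s m) ->
  forall m s, C s m = \sum_(0 <= j < s) C (s - j)%N 0%N * (A m * Z_even R j m)
                      + A m * z s m.
Proof.
move=> C0 z0 zS CS; elim => [|m ih] [|s].
- by rewrite big_nil add0r C0.
- rewrite big_nat_recl //= subn0 gbinom_half_sqr0 Z_even0 z0 !mulr1 mulr0 addr0.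
  by rewrite big1 ?addr0 // => j _; rewrite Z_evenS0 !mulr0.
- by rewrite big_nil add0r C0.
have m1 : m.+1%:R ^+ 2 != 0 :> R by rewrite expf_eq0 /= pnatr_eq0.
apply: (mulfI m1); rewrite CS.
have wE : (m%:R + 1 / 2) ^+ 2 * w m = 1.
  by rewrite /w divff // expf_eq0 /= half_neq0.
have AS c : m.+1%:R ^+ 2 * (A m.+1 * c) = (m%:R + 1 / 2) ^+ 2 * A m * c.
  by rewrite mulrA gbinom_half_sqrS.
rewrite mulrDr AS big_distrr /=.
under [in RHS]eq_bigr do rewrite mulrCA AS.
rewrite (ih s.+1) (ih s) zS big_nat_recl //= [in LHS]big_nat_recl //= !Z_even0.
under [in RHS]eq_bigr do rewrite Z_evenS subSS.
have -> : \sum_(0 <= i < s) C (s - i)%N 0%N *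
      ((m%:R + 1 / 2) ^+ 2 * A m * (Z_even R i.+1 m - w m * Z_even R i m)) =
    (m%:R + 1 / 2) ^+ 2 * (\sum_(0 <= i < s)
        C (s.+1 - i.+1)%N 0%N * (A m * Z_even R i.+1 m))
    - (m%:R + 1 / 2) ^+ 2 * w m * \sum_(0 <= i < s) C (s - i)%N 0%N * (A m * Z_even R i m).
  rewrite !big_distrr /= -sumrB; apply: eq_bigr => i _; rewrite subSS; ring.
have -> : (m%:R + 1 / 2) ^+ 2 * A m * (z s.+1 m - w m * z s m) =
   (m%:R + 1 / 2) ^+ 2 * (A m * z s.+1 m) - (m%:R + 1 / 2) ^+ 2 * w m * (A m * z s m).
  by ring.
by rewrite wE; ring.
Qed.

Let D n (c : nat -> R) : R :=
  \sum_(0 <= m < n.+1) (-1) ^+ m * 'C(n, m)%:R * c m.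

(** The binomial transform [D n] acts on [m] alone, so it carries the solution for [B] to a relation
    for J with coefficients B(., 0) = J(., 0). This is the defining relation of [Jt], term by
    term. *)
Lemma normalized_of_recurrence (B Jt : nat -> nat -> R) :
  (forall m, B 0%N m = 0) ->
  (forall m, B 1%N m = (2 * m%:R + 1)^-1) ->
  (forall k m, m.+1%:R ^+ 2 * B k.+2 m.+1 =
               (m%:R + 1 / 2) ^+ 2 * B k.+2 m - B k m) ->
  B 2 0%N != 0 ->
  (forall k n, J R k n = \sum_(0 <= m < n.+1) (-1) ^+ m * 'C(n, m)%:R * B k m) ->
  normalized_J Jt ->
  forall s n,
  Jt (2 * s + 2)%N n =
    \sum_(0 <= k < n.+1)
      (-1) ^+ k * gbinom (- (1 / 2)) k ^+ 2 * 'C(n, k)%:R * Z_even R s k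
  /\
  Jt (2 * s.+1 + 1)%N n =
    \sum_(0 <= k < n.+1)
      (-1) ^+ k * gbinom (- (1 / 2)) k ^+ 2 * 'C(n, k)%:R * Z_odd R s.+1 k.
Proof.
move=> B0 B1 BS B20 JE [Jt1 Jte Jto] s n.
have JD k n' : J R k n' = D n' (B k) by exact: JE.
have Jk0 k : J R k 0 = B k 0%N.
  by rewrite JE big_nat1 expr0 bin0 !mul1r.
have DD n' (I : seq nat) (a : nat -> R) (c : nat -> nat -> R) c' :
    D n' (fun m => \sum_(j <- I) a j * c j m + c' m) =
    \sum_(j <- I) a j * D n' (c j) + D n' c'.
  rewrite /D; under eq_bigr do rewrite mulrDr.
  rewrite big_split /=; congr (_ + _).
  under eq_bigr do rewrite big_distrr /=.
  rewrite exchange_big /=; apply: eq_bigr => j _; rewrite big_distrr /=.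
  by apply: eq_bigr => m _; ring.
have DZ (c : nat -> R) : \sum_(0 <= k < n.+1)
      (-1) ^+ k * gbinom (- (1 / 2)) k ^+ 2 * 'C(n, k)%:R * c k =
    D n (fun m => A m * c m).
  by apply: eq_bigr => k _; rewrite /A; ring.
(* Even indices have no boundary contribution because B_0 = 0, so [z] is taken to be 0. *)
have Be s' m : B (2 * s')%N m =
    \sum_(0 <= j < s') B (2 * (s' - j))%N 0%N * (A m * Z_even R j m).
  have := @recurrence_solution (fun s m => B (2 * s)%N m) (fun _ _ => 0)
    _ _ _ _ m s' => /= ->; first by rewrite mulr0 addr0.
  - by move=> ?; rewrite muln0 B0 mulr0.
  - by [].
  - by move=> *; rewrite mulr0 subr0.
  - by move=> t m'; rewrite (_ : (2 * t.+1 = (2 * t).+2)%N) ?BS //; lia.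
have Bo s' m : B (2 * s' + 1)%N m =
    \sum_(0 <= j < s') B (2 * (s' - j) + 1)%N 0%N * (A m * Z_even R j m)
    + A m * z_odd s' m.
  have := @recurrence_solution (fun s m => B (2 * s + 1)%N m) z_odd
    _ _ _ _ m s' => /= -> //.
  - move=> m'; rewrite B1 /= invfM mulrCA divff ?mulr1 //.
    exact: gbinom_half_sqr_neq0.
  - by move=> t; exact: Z_oddS0.
  - by move=> [|t] m'; [exact: Z_odd1S|exact: Z_oddSS].
  - by move=> t m'; rewrite (_ : (2 * t.+1 + 1 = (2 * t + 1).+2)%N) ?BS //; lia.
(* The relation for index 2(s' + 1) contains one value not covered by the induction hypothesis,
   namely j = s', whose coefficient is B_2(0). *)
have JtE n' s' : Jt (2 * s' + 2)%N n' = D n' (fun m => A m * Z_even R s' m).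
  elim/ltn_ind: s' => s' ih.
  have := Jte s'.+1 n' isT; rewrite JD.
  rewrite (_ : B (2 * s'.+1)%N = fun m => \sum_(0 <= j < s'.+1)
      B (2 * (s'.+1 - j))%N 0%N * (A m * Z_even R j m) + 0); last first.
    by apply/funext => m; rewrite Be addr0.
  rewrite DD (_ : D n' _ = 0) ?addr0; last first.
    by rewrite /D big1 // => *; rewrite mulr0.
  rewrite !big_nat_recr //= subSnn muln1.
  rewrite (_ : (2 * s'.+1 - 2 * s' = 2)%N); last by lia.
  rewrite Jk0.
  rewrite (@eq_big_nat _ _ _ _ _ (fun j => J R (2 * s'.+1 - 2 * j) 0 * Jt (2 * j + 2)%N n')
     (fun j => B (2 * (s'.+1 - j))%N 0%N * D n' (fun m => A m * Z_even R j m))); last first.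
    by move=> j /andP[_ js]; rewrite ih // Jk0 mulnBr.
  by move/addrI/(mulfI B20).
split; first by rewrite JtE DZ.
have := Jto s.+1 n isT; rewrite JD.
rewrite (_ : B (2 * s.+1 + 1)%N = fun m => \sum_(0 <= j < s.+1)
      B (2 * (s.+1 - j) + 1)%N 0%N * (A m * Z_even R j m)
      + A m * z_odd s.+1 m); last by apply/funext => m; rewrite Bo.
rewrite DD DZ.
rewrite (@eq_big_nat _ _ _ _ _ (fun j => J R (2 * s.+1 + 1 - 2 * j) 0 * Jt (2 * j + 2)%N n)
     (fun j => B (2 * (s.+1 - j) + 1)%N 0%N * D n (fun m => A m * Z_even R j m))); last first.
  move=> j /andP[_ js]; rewrite JtE Jk0; congr (B _ _ * _); lia.
(* The sums over the even-indexed values agree and cancel, which leaves the boundary term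
   [z_odd s.+1], that is, [Z_odd]. *)
by move/addrI/esym.
Qed.

End normalized.

(** * Improper integrals on the positive half-line *)

Section improper_FTC.
Local Open Scope classical_set_scope.
Context {R : realType}.
Notation mu := (@lebesgue_measure R).

Lemma is_derive_continuous (f : R -> R) (x df : R) :
  is_derive x 1 f df -> {for x, continuous f}.
Proof.
by case=> fx _; exact/differentiable_continuous/derivable1_diffP.
Qed.

Lemma continuous_gt0_within (f : R -> R) (a b : R) : 0 < a ->
  (forall x : R, 0 < x -> {for x, continuous f}) ->
  {within `[a, b], continuous f}.
Proof.
move=> a0 cf; apply: continuous_in_subspaceT => x.
by rewrite inE/= in_itv/= => /andP[ax _]; apply: cf; exact: lt_le_trans ax.
Qed.

Lemma continuous_gt0_measurable (f : R -> R) :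
  (forall x : R, 0 < x -> {for x, continuous f}) ->
  measurable_fun `](0 : R), +oo[ (fun x => (f x)%:E).
Proof.
move=> cf; apply/measurable_EFinP.
apply: open_continuous_measurable_fun => // x.
by rewrite inE/= in_itv/= andbT => /cf.
Qed.

(** The upper end is n + 2 so that the interval is nondegenerate already for n = 0. *)
Let E (n : nat) : set R := `[n.+1%:R^-1, n.+2%:R].

Let E_bigcup : \bigcup_n E n = `]0, +oo[.
Proof.
apply/seteqP; split => x /=.
  move=> [n _]; rewrite /E /= !in_itv/= andbT => /andP[+ _].
  by apply: lt_le_trans; rewrite invr_gt0 ltr0n.
rewrite in_itv/= andbT => x0.
exists (Num.truncn x + Num.truncn x^-1)%N => //; rewrite /E /= in_itv/=; apply/andP; split.
  rewrite -[leRHS]invrK lef_pV2 ?posrE ?ltr0n ?invr_gt0//.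
  apply: (le_trans (ltW (truncnS_gt _))).
  by rewrite ler_nat ltnS leq_addl.
apply: (le_trans (ltW (truncnS_gt _))).
by rewrite ler_nat ltnS leqW // leq_addr.
Qed.

Let cvg_E (f : R -> R) : (forall x : R, 0 < x -> 0 <= f x) ->
  (forall x : R, 0 < x -> {for x, continuous f}) ->
  (\int[mu]_(x in E n) (f x)%:E @[n --> \oo] -->
   \int[mu]_(x in `]0%R, +oo[) (f x)%:E)%E.
Proof.
move=> f0 cf; rewrite -E_bigcup.
have E0 i x : E i x -> 0 < x.
  rewrite /E /= in_itv/= => /andP[+ _]; apply: lt_le_trans.
  by rewrite invr_gt0 ltr0n.
apply: ge0_nondecreasing_set_cvg_integral => //=.
- apply/nondecreasing_seqP => n; apply/subsetPset => x; rewrite /E /= !in_itv/= => /andP[xn nx].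
  apply/andP; split.
    by apply: le_trans xn; rewrite lef_pV2 ?posrE ?ltr0n// ler_nat.
  by apply: (le_trans nx); rewrite ler_nat.
- by move=> i; exact: measurable_itv.
- move=> i; apply: measurable_funS (continuous_gt0_measurable cf) => //.
  by move=> x /= /E0; rewrite in_itv/= => ->.
- by move=> i x /E0 x0; rewrite lee_fin f0.
Qed.

(** The derivative is split into two nonnegative parts kept on opposite sides. Monotone convergence
    along the compact intervals [E n] then applies to each part, and the identity holds in the
    extended reals without prior integrability. *)
Lemma ge0_improper_FTC (f1 f2 F : R -> R) (a b : R) :
  (forall x : R, 0 < x -> 0 <= f1 x) -> (forall x : R, 0 < x -> 0 <= f2 x) ->
  (forall x : R, 0 < x -> {for x, continuous f1}) ->
  (forall x : R, 0 < x -> {for x, continuous f2}) ->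
  (forall x : R, 0 < x -> is_derive x 1 F (f1 x - f2 x)) ->
  F x @[x --> 0^'+] --> a -> F x @[x --> +oo] --> b ->
  (\int[mu]_(x in `]0%R, +oo[) (f1 x)%:E =
   \int[mu]_(x in `]0%R, +oo[) (f2 x)%:E + (b - a)%:E)%E.
Proof.
move=> f10 f20 cf1 cf2 dF Fa Fb.
have E0 n : (n.+1%:R^-1 : R) < n.+2%:R.
  by apply: (@le_lt_trans _ _ 1); rewrite ?invf_le1 ?ltr0n// ?ler1n// ltr1n.
have En (n : nat) : (\int[mu]_(x in E n) (f1 x)%:E =
    \int[mu]_(x in E n) (f2 x)%:E + (F n.+2%:R - F n.+1%:R^-1)%:E)%E.
  have n0 : 0 < (n.+1%:R^-1 : R) by rewrite invr_gt0 ltr0n.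
  have If (f : R -> R) : (forall x : R, 0 < x -> {for x, continuous f}) ->
      mu.-integrable (E n) (EFin \o f).
    move=> cf; apply: continuous_compact_integrable; first exact: segment_compact.
    exact: continuous_gt0_within.
  have cf12 x : 0 < x -> {for x, continuous (fun x => f1 x - f2 x)}.
    by move=> x0; apply: continuousB; [exact: cf1|exact: cf2].
  have cF x : 0 < x -> {for x, continuous F}.
    by move=> /dF/is_derive_continuous.
  rewrite EFinB -(@continuous_FTC2 _ (fun x => f1 x - f2 x) F) //.
  - rewrite -integralD//=; [|exact: measurable_itv|exact: If|exact: If].
    by apply: eq_integral => x _; rewrite -EFinD addrC subrK.
  - exact: continuous_gt0_within.
  - split.
    + move=> x; rewrite in_itv/= => /andP[nx _].
      by have [] := dF x (lt_trans n0 nx).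
    + exact/cvg_at_right_filter/cF.
    + by apply/cvg_at_left_filter/cF; rewrite ltr0n.
  - move=> x; rewrite in_itv/= => /andP[nx _]; rewrite derive1E.
    by have [_ ->] := dF x (lt_trans n0 nx).
have c1 := cvg_E f10 cf1.
have c2 := cvg_E f20 cf2.
apply: (cvg_unique _ c1) => //; rewrite (funext En).
apply: cvgeD => //.
  by rewrite fin_num_adde_defl.
apply/cvg_EFin; first exact: nearW.
apply: cvgB.
- apply/((cvg_pinftyP F b).1 Fb).
  under eq_fun do rewrite -addn2.
  by have := cvgr_idn (R := R); rewrite -(cvg_shiftn 2).
- apply/((cvg_at_rightP F 0 a).1 Fa); split => [n|]; first by rewrite invr_gt0 ltr0n.
  rewrite gtr0_cvgV0; last by apply: nearW => n; rewrite ltr0n.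
  by have := cvgr_idn (R := R); rewrite -(cvg_shiftn 1); under eq_fun do rewrite addn1.
Qed.

Lemma measurable_gt0 :
  measurable (`]0%R, +oo[%classic : set (measurableTypeR R)).
Proof. exact: measurable_itv. Qed.

End improper_FTC.

(** * Integrability together with the value of the integral *)

Section has_integral.
Local Open Scope classical_set_scope.
Context d (T : measurableType d) (R : realType).
Context (mu : {measure set T -> \bar R}) (D : set T) (mD : measurable D).

(** Integrability travels with the value so that finite sums with alternating signs can be
    integrated term by term. *)
Definition has_integral (f : T -> R) (v : R) : Prop :=
  mu.-integrable D (EFin \o f) /\ (\int[mu]_(x in D) (f x)%:E = v%:E)%E.

Lemma has_integralZ (c : R) f v :
  has_integral f v -> has_integral (fun x => c * f x) (c * v).
Proof.
move=> [If fv]; split; first exact: (integrableZl mD c If).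
under eq_integral do rewrite EFinM.
by rewrite (integralZl mD If) fv EFinM.
Qed.

Lemma has_integralD f g v w : has_integral f v -> has_integral g w ->
  has_integral (fun x => f x + g x) (v + w).
Proof.
move=> [If fv] [Ig gw]; split; first exact: (integrableD mD If Ig).
under eq_integral do rewrite EFinD.
by rewrite (integralD mD If Ig) fv gw.
Qed.

Lemma has_integral_sum (I : Type) (s : seq I) (f : I -> T -> R) (v : I -> R) :
  (forall i, has_integral (f i) (v i)) ->
  has_integral (fun x => \sum_(i <- s) f i x) (\sum_(i <- s) v i).
Proof.
move=> fv; split.
  rewrite (_ : _ \o _ = fun x => (\sum_(i <- s) (EFin \o f i) x)%E).
    by apply: integrable_sum => // i _; have [] := fv i.
  by apply/funext => x /=; rewrite sumEFin.
under eq_integral do rewrite -sumEFin.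
rewrite (integral_sum mD (f := fun i x => (f i x)%:E)); last first.
  by move=> i; have [] := fv i.
by rewrite -sumEFin; apply: eq_bigr => i _; have [] := fv i.
Qed.

Lemma eq_has_integral (f g : T -> R) v : (forall x, D x -> f x = g x) ->
  has_integral f v -> has_integral g v.
Proof.
move=> fg [If fv]; split.
  by apply: eq_integrable If => // x /[1!inE] Dx /=; rewrite fg.
by rewrite -fv; apply: eq_integral => x /[1!inE] Dx; rewrite fg.
Qed.

Lemma ge0_has_integral (f : T -> R) v :
  measurable_fun D f -> (forall x, D x -> 0 <= f x) ->
  (\int[mu]_(x in D) (f x)%:E = v%:E)%E -> has_integral f v.
Proof.
move=> mf f0 fv; split=> //; apply/integrableP; split; first exact/measurable_EFinP.
rewrite (eq_integral (fun x => (f x)%:E)) ?fv ?ltry // => x /[1!inE] Dx /=.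
by rewrite ger0_norm // f0.
Qed.

End has_integral.

(** * Derivatives, sign arguments and exponential moments *)

Section derive_aux.
Local Open Scope classical_set_scope.
Context {R : realType}.
Implicit Types (f g : R -> R) (x : R).

Lemma is_derive_mul f g x df dg : is_derive x 1 f df -> is_derive x 1 g dg ->
  is_derive x 1 (fun y => f y * g y) (f x * dg + g x * df).
Proof. by move=> ? ?; exact: is_deriveM. Qed.

Lemma is_derive_exp f n x df : is_derive x 1 f df ->
  is_derive x 1 (fun y => f y ^+ n) (n%:R * f x ^+ n.-1 * df).
Proof.
move=> fx; have -> : (fun y => f y ^+ n) = f ^+ n.
  by apply/funext => y; rewrite exprfctE.
exact: is_deriveX.
Qed.

Lemma is_derive_expRM (c x : R) :
  is_derive x 1 (fun y => expR (c * y)) (c * expR (c * x)).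
Proof.
have -> : (fun y => expR (c * y)) = expR \o (c \*: id) by [].
by apply: is_derive_eq; rewrite /GRing.scale /= mulr1 mulrC.
Qed.

Lemma ge0_of_derive f (df : R -> R) : (forall x, is_derive x 1 f (df x)) ->
  (forall x, 0 <= x -> 0 <= df x) -> 0 <= f 0 -> forall x, 0 <= x -> 0 <= f x.
Proof.
move=> dfE df0 f0 x; rewrite le_eqVlt => /predU1P[<-//|x0].
have [|c] := MVT x0 (fun y _ => dfE y).
  by apply: derivable_within_continuous => y _; have [] := dfE y.
rewrite in_itv/= => /andP[/ltW c0 _] /eqP; rewrite subr_eq => /eqP ->.
by rewrite addr_ge0 // mulr_ge0 // ?df0 // subr0 ltW.
Qed.

Lemma cvg_exprn_expRN n (c : R) : 0 < c ->
  x ^+ n * expR (- c * x) @[x --> +oo] --> (0 : R).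
Proof.
move=> c0.
(* The single Taylor term (cx)^(n+1)/(n+1)! is at most exp(cx), which bounds the function by this
   constant times 1/x. *)
have K0 : 0 <= n.+1`!%:R / c ^+ n.+1 :> R.
  by rewrite divr_ge0 // ?ler0n // exprn_ge0 // ltW.
apply: (@squeeze_cvgr _ _ _ _ (cst 0) (fun x => n.+1`!%:R / c ^+ n.+1 * x^-1)).
- near=> x.
  have x0 : 0 < x by near: x; exact: nbhs_pinfty_gt.
  rewrite /cst mulr_ge0 ?expR_ge0 ?exprn_ge0 ?(ltW x0) //= mulNr expRN.
  rewrite ler_pdivrMr ?expR_gt0 //.
  have cx : 0 <= c * x by rewrite ltW // mulr_gt0.
  have := expR_ge1Dxn n cx => h.
  have {}h : (c * x) ^+ n.+1 / n.+1`!%:R <= expR (c * x).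
    by apply: le_trans h; rewrite lerDr.
  rewrite -ler_pdivrMl; last first.
    by rewrite mulr_gt0 ?invr_gt0// divr_gt0 // ?ltr0n ?fact_gt0// exprn_gt0.
  apply: le_trans h; rewrite exprMn exprS le_eqVlt; apply/orP; left; apply/eqP.
  have f0 : n.+1`!%:R != 0 :> R by rewrite pnatr_eq0 -lt0n fact_gt0.
  rewrite [x ^+ n.+1]exprS; move: (n.+1`!%:R) f0 => k k0.
  by field; rewrite k0 lt0r_neq0 // ?expf_neq0 ?lt0r_neq0.
- exact: cvg_cst.
- rewrite -[X in _ --> X](mulr0 (n.+1`!%:R / c ^+ n.+1)).
  apply: cvgM; first exact: cvg_cst.
  rewrite gtr0_cvgV0; first exact: cvg_id.
  exact: nbhs_pinfty_gt.
Unshelve. all: by end_near. Qed.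

Lemma has_integral_exprn_expRN n (c : R) : 0 < c ->
  has_integral (@lebesgue_measure R) `]0, +oo[
    (fun x => x ^+ n * expR (- c * x)) (n`!%:R / c ^+ n.+1).
Proof.
move=> c0.
have df k x : is_derive x 1 (fun y => - (y ^+ k * expR (- c * y)))
    (c * (x ^+ k * expR (- c * x)) - k%:R * (x ^+ k.-1 * expR (- c * x))).
  have := is_derive_mul (is_derive_exp k (is_derive_id x 1)) (is_derive_expRM (- c) x).
  move=> /is_deriveN h; apply: (is_derive_eq h); ring.
have dg k x : is_derive x 1 (fun y => y ^+ k * expR (- c * y))
    (- (c * (x ^+ k * expR (- c * x)) - k%:R * (x ^+ k.-1 * expR (- c * x)))).
  have := is_derive_mul (is_derive_exp k (is_derive_id x 1)) (is_derive_expRM (- c) x).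
  move=> h; apply: (is_derive_eq h); ring.
have cf k x : {for x, continuous (fun y : R => y ^+ k * expR (- c * y))}.
  exact: is_derive_continuous (dg k x).
have cM (a : R) (f : R -> R) x : {for x, continuous f} -> {for x, continuous (fun y => a * f y : R)}.
  by move=> fx; apply: continuousM => //; exact: cst_continuous.
have f0 k x : 0 < x -> 0 <= x ^+ k * expR (- c * x).
  by move=> x0; rewrite mulr_ge0 ?expR_ge0// exprn_ge0 // ltW.
(* Integration by parts: c I_k = k I_(k-1) + 0^k. With 0^0 = 1 this also covers k = 0, where the
   coefficient k removes the term with the truncated exponent. *)
have I k := @ge0_improper_FTC R (fun x => c * (x ^+ k * expR (- c * x)))
  (fun x => k%:R * (x ^+ k.-1 * expR (- c * x)))
  (fun y => - (y ^+ k * expR (- c * y))) (- (0 ^+ k)) 0.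
apply: ge0_has_integral => //.
- apply/measurable_EFinP; apply: continuous_gt0_measurable => x _; exact: cf.
- by move=> x; rewrite /= in_itv/= andbT => /f0.
have mf k : measurable_fun `](0 : R), +oo[ (fun x : R => (x ^+ k * expR (- c * x))%:E).
  by apply: continuous_gt0_measurable => x _; exact: cf.
have f0' k x : `]0, +oo[%classic x -> (0 <= (x ^+ k * expR (- c * x))%:E)%E.
  by rewrite /= in_itv/= andbT lee_fin => /f0.
have {}I k : (c%:E * \int[lebesgue_measure]_(x in `]0%R, +oo[) (x ^+ k * expR (- c * x))%:E =
   k%:R%:E * \int[lebesgue_measure]_(x in `]0%R, +oo[) (x ^+ k.-1 * expR (- c * x))%:E
   + (0 ^+ k)%:E)%E.
  rewrite -ge0_integralZl_EFin ?(ltW c0)//; [|exact: f0'|exact: mf].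
  rewrite -ge0_integralZl_EFin ?ler0n//; [|exact: f0'|exact: mf].
  have := I k; rewrite sub0r opprK; apply.
  - by move=> x x0; rewrite mulr_ge0 ?f0// ltW.
  - by move=> x x0; rewrite mulr_ge0 ?f0// ler0n.
  - by move=> x _; exact: cM.
  - by move=> x _; exact: cM.
  - have -> : - 0 ^+ k = (fun y : R => - (y ^+ k * expR (- c * y))) 0.
      by rewrite /= mulr0 expR0 mulr1.
    exact/cvg_at_right_filter/(is_derive_continuous (df k 0)).
  - by rewrite -[X in _ --> X]oppr0; apply: cvgN; exact: cvg_exprn_expRN.
have c0' : c%:E \is a fin_num by [].
elim: n => [|n ih].
  have := I 0%N; rewrite mul0e add0e expr0 fact0 div1r expr1 => /(congr1 (mule (c^-1)%:E)).
  by rewrite muleA -EFinM mulVf ?gt_eqF// mul1e mule1.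
have := I n.+1; rewrite /= ih expr0n /= adde0 -EFinM => /(congr1 (mule (c^-1)%:E)).
rewrite muleA -EFinM mulVf ?gt_eqF// mul1e => ->; rewrite -EFinM; congr EFin.
rewrite factS natrM [c ^+ n.+2]exprS; move: (n.+1%:R) => k.
by field; rewrite expf_neq0 gt_eqF.
Qed.

End derive_aux.

(** * The functions F_m and their moments *)

Section hyperbolic.
Local Open Scope classical_set_scope.
Context {R : realType}.
Implicit Types (p : R) (m j : nat).

Definition sh p : R := (expR p - expR (- p)) / 2.
Definition ch p : R := (expR p + expR (- p)) / 2.

Lemma sh0 : sh 0 = 0. Proof. by rewrite /sh oppr0 subrr mul0r. Qed.

Lemma ch0 : ch 0 = 1. Proof. by rewrite /ch oppr0 expR0; field. Qed.

Lemma sqr_ch p : ch p ^+ 2 = 1 + sh p ^+ 2.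
Proof. by rewrite /ch /sh; have := expRxMexpNx_1 p; nra. Qed.

Lemma chE p : ch p = sh p + expR (- p).
Proof. by rewrite /ch /sh; lra. Qed.

Lemma is_derive_expRN p : is_derive p 1 (fun x => expR (- x)) (- expR (- p)).
Proof.
have := is_derive_expRM (-1) p; rewrite !mulN1r.
by under eq_fun do rewrite mulN1r.
Qed.

Lemma is_derive_sh p : is_derive p 1 sh (ch p).
Proof.
have h := is_derive_mul (is_deriveB (is_derive_expR p) (is_derive_expRN p))
  (is_derive_cst (2^-1 : R) p 1).
by apply: (is_derive_eq h); rewrite mulr0 add0r /cst /ch; ring.
Qed.

Lemma is_derive_ch p : is_derive p 1 ch (sh p).
Proof.
have h := is_derive_mul (is_deriveD (is_derive_expR p) (is_derive_expRN p))
  (is_derive_cst (2^-1 : R) p 1).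
by apply: (is_derive_eq h); rewrite mulr0 add0r /cst /sh; ring.
Qed.

Lemma sh_gt0 p : 0 < p -> 0 < sh p.
Proof. by move=> p0; rewrite /sh divr_gt0 // subr_gt0 ltr_expR; lra. Qed.

Lemma sh_ge0 p : 0 <= p -> 0 <= sh p.
Proof. by rewrite le_eqVlt => /predU1P[<-|/sh_gt0/ltW//]; rewrite sh0. Qed.

Lemma ch_ge1 p : 1 <= ch p.
Proof.
have := expR_gt0 p; have := expR_gt0 (- p); have := expRxMexpNx_1 p.
rewrite /ch; set a := expR p; set b := expR (- p) => ab b0 a0.
rewrite ler_pdivlMr // mul1r -subr_ge0 -(pmulr_rge0 _ a0).
by rewrite (_ : _ * _ = (a - 1) ^+ 2) ?sqr_ge0 //; rewrite mulrBr mulrDr ab; ring.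
Qed.

(* The primitive of [sh ^+ (2 * m)] vanishing at [0], by integration by parts. *)
Fixpoint sh_prim m p : R :=
  if m is m'.+1 then
    (sh p ^+ (2 * m').+1 * ch p - (2 * m').+1%:R * sh_prim m' p) / (2 * m').+2%:R
  else p.

Lemma is_derive_sh_prim m p : is_derive p 1 (sh_prim m) (sh p ^+ (2 * m)).
Proof.
elim: m => [|m ih] /=; first by rewrite muln0 expr0; exact: is_derive_id.
have h1 := is_derive_mul (is_derive_exp (2 * m).+1 (is_derive_sh p)) (is_derive_ch p).
have h2 := is_derive_mul (is_derive_cst ((2 * m).+1%:R : R) p 1) ih.
have h := is_derive_mul (is_deriveB h1 h2) (is_derive_cst ((2 * m).+2%:R^-1 : R) p 1).
apply: (is_derive_eq h) => /=; rewrite /cst mulr0 add0r.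
have n0 : (2 * m).+2%:R != 0 :> R by rewrite pnatr_eq0.
apply: (mulfI n0); rewrite mulVKf // mulnS 3!exprS.
rewrite mulr0 addr0.
have := sqr_ch p; move: (sh p) (ch p) => S C CS.
have -> : (2 * m).+2%:R = (2 * m).+1%:R + 1 :> R by rewrite -natr1.
move: ((2 * m).+1%:R) (S ^+ (2 * m)) => a T.
have -> : C * (a * T * C) = a * T * C ^+ 2 by ring.
by rewrite CS; ring.
Qed.

Lemma sh_prim0 m : sh_prim m 0 = 0.
Proof.
by elim: m => [|m ih] //=; rewrite ih sh0 exprS !mul0r mulr0 subr0 mul0r.
Qed.

Lemma sh_prim_ge0 m p : 0 <= p -> 0 <= sh_prim m p.
Proof.
apply: (ge0_of_derive (fun p => is_derive_sh_prim m p)); last by rewrite sh_prim0.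
by move=> x x0; rewrite exprn_ge0 // sh_ge0.
Qed.

(** The integrand is increasing: the difference vanishes at 0, and its derivative is p times that of
    [sh p ^+ (2 * m)]. *)
Lemma sh_prim_le m p : 0 <= p -> sh_prim m p <= p * sh p ^+ (2 * m).
Proof.
move=> p0; rewrite -subr_ge0; move: p p0.
have h p := is_deriveB (is_derive_mul (is_derive_id p 1)
  (is_derive_exp (2 * m) (is_derive_sh p))) (is_derive_sh_prim m p).
apply: (ge0_of_derive h) => [x x0|]; last by rewrite !fctE mul0r sh_prim0 subrr.
have C0 : 0 <= ch x by apply: le_trans (ch_ge1 _).
rewrite mulr1 addrK; apply: mulr_ge0 => //; apply: mulr_ge0 => //.
by apply: mulr_ge0; rewrite ?ler0n ?exprn_ge0 ?sh_ge0.
Qed.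

Lemma sh_prim_le_sh m p : 0 <= p ->
  (2 * m).+1%:R * sh_prim m p <= sh p ^+ (2 * m).+1.
Proof.
move=> p0; rewrite -subr_ge0; move: p p0.
have h p := is_deriveB (is_derive_exp (2 * m).+1 (is_derive_sh p))
  (is_derive_mul (is_derive_cst ((2 * m).+1%:R : R) p 1) (is_derive_sh_prim m p)).
apply: (ge0_of_derive h) => [x x0|]; last by rewrite !fctE sh_prim0 sh0 exprS mul0r mulr0 subrr.
rewrite mulr0 addr0 /cst -mulrA -mulrBr mulr_ge0 //.
rewrite -[X in _ - X]mulr1 -mulrBr mulr_ge0 ?exprn_ge0 ?sh_ge0 // subr_ge0 ch_ge1 //.
Qed.

(** The difference of the two sides has derivative (2m+1) [sh_prim m p * sh p]. With [sh_prim_le_sh]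
    this encloses (2m+1) F_m between 1/cosh and 1. *)
Lemma sh_le_sh_prim m p : 0 <= p ->
  sh p ^+ (2 * m).+1 <= (2 * m).+1%:R * (ch p * sh_prim m p).
Proof.
move=> p0; rewrite -subr_ge0; move: p p0.
have h p := is_deriveB (is_derive_mul (is_derive_cst ((2 * m).+1%:R : R) p 1)
  (is_derive_mul (is_derive_ch p) (is_derive_sh_prim m p)))
  (is_derive_exp (2 * m).+1 (is_derive_sh p)).
apply: (ge0_of_derive h) => [x x0|]; last first.
  by rewrite !fctE sh_prim0 sh0 exprS mul0r mulr0 mulr0 subrr.
rewrite mulr0 addr0 /cst /= (_ : _ - _ = (2 * m).+1%:R * (sh_prim m x * sh x)); last by ring.
by apply: mulr_ge0 => //; apply: mulr_ge0; rewrite ?sh_prim_ge0 ?sh_ge0.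
Qed.

Definition Fsh m p : R := sh_prim m p / sh p ^+ (2 * m).+1.

(** The derivative of [Fsh m], arranged so that [Fsh_bounds] controls the numerator near 0. *)
Definition dFsh m p : R := (1 - (2 * m).+1%:R * (ch p * Fsh m p)) / sh p.

Lemma is_derive_Fsh m p : 0 < p -> is_derive p 1 (Fsh m) (dFsh m p).
Proof.
move=> p0; have S0 := sh_gt0 p0.
have N0 : sh p ^+ (2 * m).+1 != 0 by rewrite expf_neq0 // gt_eqF.
have h1 := is_deriveV (f := fun y => sh y ^+ (2 * m).+1) N0 (is_derive_exp (2 * m).+1 (is_derive_sh p)).
have h := is_derive_mul (is_derive_sh_prim m p) h1.
apply: (is_derive_eq h); rewrite /dFsh /Fsh /GRing.scale /= ![sh p ^+ (2 * m).+1]exprS.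
have T0 : sh p ^+ (2 * m) != 0 by rewrite expf_neq0 // gt_eqF.
move: (sh p ^+ (2 * m)) T0 ((2 * m).+1%:R) => T T0 c.
by field; rewrite T0 gt_eqF.
Qed.

Lemma FshS m p : 0 < p ->
  (2 * m).+2%:R ^+ 2 * Fsh m.+1 p =
  (2 * m).+2%:R * (ch p - (2 * m).+1%:R * Fsh m p) / sh p ^+ 2.
Proof.
move=> p0; have S0 := sh_gt0 p0.
rewrite /Fsh /= mulnS !exprS.
have T0 : sh p ^+ (2 * m) != 0 by rewrite expf_neq0 // gt_eqF.
have n0 : (2 * m).+2%:R != 0 :> R by rewrite pnatr_eq0.
move: (sh p ^+ (2 * m)) T0 ((2 * m).+1%:R) ((2 * m).+2%:R) n0 => T T0 c d d0.
by field; rewrite T0 d0 gt_eqF.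
Qed.

Lemma is_derive_dFsh m p : 0 < p ->
  is_derive p 1 (dFsh m)
    ((2 * m).+1%:R ^+ 2 * Fsh m p - (2 * m).+2%:R ^+ 2 * Fsh m.+1 p).
Proof.
move=> p0; have S0 := sh_gt0 p0; have S1 : sh p != 0 by rewrite gt_eqF.
have h1 := is_deriveV (f := sh) S1 (is_derive_sh p).
have h2 := is_derive_mul (is_derive_ch p) (is_derive_Fsh m p0).
have h3 := is_derive_mul (is_derive_cst ((2 * m).+1%:R : R) p 1) h2.
have h := is_derive_mul (is_deriveB (is_derive_cst (1 : R) p 1) h3) h1.
apply: (is_derive_eq h); rewrite FshS //.
have -> : (2 * m).+2%:R = (2 * m).+1%:R + 1 :> R by rewrite -natr1.
rewrite !fctE /= /dFsh /GRing.scale /=; have := sqr_ch p.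
move: (Fsh m p) ((2 * m).+1%:R) (sh p) S1 (ch p) => F c S S1 C CS.
apply/eqP; rewrite -subr_eq0; apply/eqP.
(* The two expressions for F'' differ by a multiple of cosh^2 - 1 - sinh^2, which [field] alone
   cannot know to be zero. *)
transitivity ((C ^+ 2 - (1 + S ^+ 2)) * (c * (c + 1) * F) / S ^+ 2); last first.
  by rewrite CS subrr !mul0r.
by field.
Qed.

Lemma Fsh_ge0 m p : 0 < p -> 0 <= Fsh m p.
Proof.
by move=> p0; rewrite divr_ge0 ?sh_prim_ge0 ?exprn_ge0 ?sh_ge0 // ltW.
Qed.

Lemma Fsh_le m p : 0 < p -> Fsh m p <= p / sh p.
Proof.
move=> p0; have S0 := sh_gt0 p0.
rewrite ler_pdivrMr ?exprn_gt0 // exprS mulrA divfK ?gt_eqF //.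
by rewrite sh_prim_le // ltW.
Qed.

Lemma Fsh_bounds m p : 0 < p -> 1 / ch p <= (2 * m).+1%:R * Fsh m p <= 1.
Proof.
move=> p0; have S0 := sh_gt0 p0.
have C0 : 0 < ch p by apply: lt_le_trans (ch_ge1 _).
rewrite mulrA ler_pdivlMr ?exprn_gt0 // ler_pdivrMr ?exprn_gt0 //.
rewrite !mul1r sh_prim_le_sh ?(ltW p0) // andbT mulrC ler_pdivrMr //.
by rewrite -mulrA [sh_prim _ _ * _]mulrC sh_le_sh_prim // ltW.
Qed.

(** Cleared of denominators this is (1 + 2p) exp(-2p) <= 1. It supplies one integrable bound for
    every F_m on the whole half-line. *)
Lemma div_sh_le p : 0 < p -> p / sh p <= (1 + 2 * p) * expR (- p).
Proof.
move=> p0; have S0 := sh_gt0 p0; rewrite ler_pdivrMr //.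
have e0 := expR_gt0 (- (2 * p)).
have := expR_ge1Dx (2 * p); have := expRxMexpNx_1 (2 * p).
rewrite -mulrA.
have -> : expR (- p) * sh p = (1 - expR (- (2 * p))) / 2 :> R.
  rewrite /sh mulrA mulrBr -expRD addNr expR0 -expRD.
  by congr ((1 - expR _) / 2); ring.
move: (expR (2 * p)) (expR (- (2 * p))) e0 => a b b0 ab ap.
by nra.
Qed.

End hyperbolic.

(** * Moments of F_m and their recurrence *)

Section Fsh_moments.
Local Open Scope classical_set_scope.
Context {R : realType}.
Implicit Types (p : R) (m j n : nat).
Notation mu := (@lebesgue_measure R).

Definition Fsh_moment j m : R :=
  (\int[mu]_(p in `]0%R, +oo[) (p ^+ j * Fsh m p))%R.

Lemma continuous_exprn n p : {for p, continuous (fun x : R => x ^+ n)}.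
Proof. exact: is_derive_continuous (is_derive_exp n (is_derive_id p 1)). Qed.

Lemma continuous_moment j m p : 0 < p ->
  {for p, continuous (fun x : R => x ^+ j * Fsh m x)}.
Proof.
move=> p0; apply: continuousM; first exact: continuous_exprn.
exact: is_derive_continuous (is_derive_Fsh m p0).
Qed.

Lemma moment_ge0 j m p : 0 < p -> 0 <= p ^+ j * Fsh m p.
Proof. by move=> p0; rewrite mulr_ge0 ?Fsh_ge0 // exprn_ge0 // ltW. Qed.

Lemma has_integral_Fsh j m :
  has_integral mu `]0, +oo[ (fun p => p ^+ j * Fsh m p) (Fsh_moment j m).
Proof.
have I : mu.-integrable `]0, +oo[ (EFin \o (fun p => p ^+ j * Fsh m p)).
  have [Ig _] := has_integralD (@measurable_gt0 R)
    (has_integral_exprn_expRN j (ltr01 : 0 < 1 :> R))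
    (has_integralZ (@measurable_gt0 R) 2
      (has_integral_exprn_expRN j.+1 (ltr01 : 0 < 1 :> R))).
  apply: le_integrable Ig => //.
    by apply: continuous_gt0_measurable => p; exact: continuous_moment.
  move=> p /=; rewrite in_itv/= andbT => p0; rewrite lee_fin.
  rewrite ger0_norm ?moment_ge0 // ger0_norm; last first.
    by rewrite addr_ge0 ?mulr_ge0 ?expR_ge0 // ?exprn_ge0 // ltW.
  apply: (@le_trans _ _ (p ^+ j * ((1 + 2 * p) * expR (- p)))).
    rewrite ler_wpM2l ?exprn_ge0 ?(ltW p0) //.
    exact: le_trans (Fsh_le m p0) (div_sh_le p0).
  by rewrite !mulN1r exprS le_eqVlt; apply/orP; left; apply/eqP; ring.
split=> //; rewrite /Fsh_moment /Rintegral fineK //.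
exact: integrable_fin_num.
Qed.

Lemma cvg_at0_sh : sh p @[p --> 0^'+] --> (0 : R).
Proof.
rewrite -[X in _ --> X](@sh0 R); apply: cvg_at_right_filter.
exact: is_derive_continuous (is_derive_sh 0).
Qed.

Lemma cvg_at0_Fsh m : Fsh m p @[p --> 0^'+] --> ((2 * m).+1%:R^-1 : R).
Proof.
have c0 : 0 < (2 * m).+1%:R :> R by rewrite ltr0n.
apply: (@squeeze_cvgr _ _ _ _ (fun p => (ch p)^-1 * (2 * m).+1%:R^-1)
  (cst (2 * m).+1%:R^-1)).
- near=> p; have p0 : 0 < p by near: p; exact: nbhs_right_gt.
  have := Fsh_bounds m p0; rewrite div1r => /andP[h1 h2].
  by rewrite /cst ler_pdivrMr // -[_^-1 in X in _ && X]div1r ler_pdivlMr // ![_ * (2 * m).+1%:R]mulrC h1 h2.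
- rewrite -[X in _ --> X]mul1r; apply: cvgM; last exact: cvg_cst.
  rewrite -[X in _ --> X]invr1; apply: cvgV; first exact: oner_neq0.
  rewrite -[X in _ --> X](@ch0 R); apply: cvg_at_right_filter.
  exact: is_derive_continuous (is_derive_ch 0).
- exact: cvg_cst.
Unshelve. all: by end_near. Qed.

(** By [Fsh_bounds], 1 <= (2m+1) F_m cosh <= cosh <= cosh^2 = 1 + sinh^2, so the numerator of [dFsh]
    lies between -sinh^2 and 0. *)
Lemma cvg_at0_dFsh m : dFsh m p @[p --> 0^'+] --> (0 : R).
Proof.
apply: (@squeeze_cvgr _ _ _ _ (fun p => - sh p) (cst 0)).
- near=> p; have p0 : 0 < p by near: p; exact: nbhs_right_gt.
  have S0 := sh_gt0 p0; have C1 := ch_ge1 p.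
  have C0 : 0 < ch p by apply: lt_le_trans C1.
  have /andP[h1 h2] := Fsh_bounds m p0.
  rewrite /dFsh /cst ler_pdivlMr // pmulr_lle0 ?invr_gt0 // subr_le0.
  move: h1; rewrite ler_pdivrMr // => h1.
  have CS := sqr_ch p.
  move: h1 h2; move: ((2 * m).+1%:R) (Fsh m p) (sh p) (ch p) S0 C1 C0 CS.
  move=> c F S C S0 C1 C0 CS h1 h2; apply/andP; split; last by nra.
  have h3 : c * F * C <= C by rewrite -[leRHS]mul1r ler_wpM2r // ltW.
  by nra.
- by rewrite -[X in _ --> X]oppr0; apply: cvgN; exact: cvg_at0_sh.
- exact: cvg_cst.
Unshelve. all: by end_near. Qed.

Lemma cvgy_exprn_expR (K : R) n :
  K * (p ^+ n * expR (- p)) @[p --> +oo] --> (0 : R).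
Proof.
rewrite -[X in _ --> X](mulr0 K); apply: cvgM; first exact: cvg_cst.
have := cvg_exprn_expRN n (ltr01 : 0 < 1 :> R).
by under eq_fun do rewrite mulN1r.
Qed.

Lemma sh_inv_le p : 1 <= p -> (sh p)^-1 <= 3 * expR (- p).
Proof.
move=> p1; have p0 : 0 < p by exact: lt_le_trans p1.
have e0 := expR_gt0 (- p).
by rewrite -(ler_pM2l p0); apply: le_trans (div_sh_le p0) _; nra.
Qed.

Lemma Fsh_ley m p : 1 <= p -> Fsh m p <= 3 * p * expR (- p).
Proof.
move=> p1; have p0 : 0 < p by exact: lt_le_trans p1.
apply: (le_trans (Fsh_le m p0)).
by rewrite mulrAC mulrC ler_wpM2r ?sh_inv_le // ltW.
Qed.

Lemma cvgy_Fsh n m : p ^+ n * Fsh m p @[p --> +oo] --> (0 : R).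
Proof.
apply: (@squeeze_cvgr _ _ _ _ (cst 0) (fun p => 3 * (p ^+ n.+1 * expR (- p)))).
- near=> p; have p1 : 1 <= p by near: p; exact: nbhs_pinfty_ge.
  have p0 : 0 < p by exact: lt_le_trans p1.
  rewrite moment_ge0 //= exprSr.
  rewrite (_ : 3 * _ = p ^+ n * (3 * p * expR (- p))); last by ring.
  by rewrite ler_wpM2l ?exprn_ge0 ?(ltW p0)// Fsh_ley.
- exact: cvg_cst.
- exact: cvgy_exprn_expR.
Unshelve. all: by end_near. Qed.

Lemma cvgy_dFsh n m : p ^+ n * dFsh m p @[p --> +oo] --> (0 : R).
Proof.
(* For p >= 1, cosh/sinh = 1 + exp(-p)/sinh <= 1 + 3 = 4 and F_m <= 3 p exp(-p); their product gives
   the 12. *)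
apply: (@squeeze_cvgr _ _ _ _
  (fun p => - (12 * (2 * m).+1%:R) * (p ^+ n.+1 * expR (- p)))
  (fun p => 3 * (p ^+ n * expR (- p)))).
- near=> p; have p1 : 1 <= p by near: p; exact: nbhs_pinfty_ge.
  have p0 : 0 < p by exact: lt_le_trans p1.
  have S0 := sh_gt0 p0; have C1 := ch_ge1 p.
  have C0 : 0 <= ch p by apply: le_trans C1.
  have h1 := sh_inv_le p1; have h2 := Fsh_ley m p1; have h3 := Fsh_ge0 m p0.
  have e0 := expR_gt0 (- p).
  have e1 : expR (- p) <= 1 by rewrite expR_le1; lra.
  have h4 : ch p / sh p <= 4.
    rewrite chE mulrDl divff ?gt_eqF // -lerBrDl (_ : 4 - 1 = 1 * 3); last by ring.
    apply: ler_pM; [exact: expR_ge0|by rewrite invr_ge0 ltW|by []|lra].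
  have dE : dFsh m p = (sh p)^-1 - (2 * m).+1%:R * (ch p / sh p * Fsh m p).
    by rewrite /dFsh; move: ((2 * m).+1%:R) => c; field; rewrite gt_eqF.
  have pn : 0 <= p ^+ n by rewrite exprn_ge0 // ltW.
  have c0 : 0 <= (2 * m).+1%:R :> R by [].
  have CS0 : 0 <= ch p / sh p by rewrite divr_ge0 // ltW.
  have h5 : ch p / sh p * Fsh m p <= 12 * (p * expR (- p)).
    rewrite (_ : 12 * _ = 4 * (3 * p * expR (- p))); last by ring.
    exact: ler_pM.
  have S1 : 0 <= (sh p)^-1 by rewrite invr_ge0 ltW.
  rewrite exprSr (_ : - _ * _ = p ^+ n * (- ((2 * m).+1%:R * (12 * (p * expR (- p)))))); last by ring.
  rewrite (_ : 3 * _ = p ^+ n * (3 * expR (- p))); last by ring.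
  apply/andP; split; rewrite ler_wpM2l // dE.
    by rewrite -[leLHS]add0r lerD // lerN2 ler_wpM2l.
  rewrite lerBlDr (le_trans h1) // lerDl.
  by apply: mulr_ge0 => //; apply: mulr_ge0.
- exact: cvgy_exprn_expR.
- exact: cvgy_exprn_expR.
Unshelve. all: by end_near. Qed.

(** Two integrations by parts at once, with primitive p^j F' - j p^(j-1) F. At infinity it vanishes;
    at 0 only j = 1 leaves a contribution, F_m(0+) = 1/(2m+1). The factors j and j - 1 remove the
    terms with truncated exponents. *)
Lemma Fsh_moment_rec j m :
  (2 * m).+1%:R ^+ 2 * Fsh_moment j m =
  (2 * m).+2%:R ^+ 2 * Fsh_moment j m.+1
  + j%:R * j.-1%:R * Fsh_moment j.-2 m
  + j%:R * 0 ^+ j.-1 / (2 * m).+1%:R.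
Proof.
have h1 := has_integralZ (@measurable_gt0 R) ((2 * m).+1%:R ^+ 2) (has_integral_Fsh j m).
have h2 := has_integralD (@measurable_gt0 R)
  (has_integralZ (@measurable_gt0 R) ((2 * m).+2%:R ^+ 2) (has_integral_Fsh j m.+1))
  (has_integralZ (@measurable_gt0 R) (j%:R * j.-1%:R) (has_integral_Fsh j.-2 m)).
have cM (a : R) (f : R -> R) x : {for x, continuous f} ->
    {for x, continuous (fun y => a * f y : R)}.
  by move=> fx; apply: continuousM => //; exact: cst_continuous.
have := @ge0_improper_FTC R
  (fun p => (2 * m).+1%:R ^+ 2 * (p ^+ j * Fsh m p))
  (fun p => (2 * m).+2%:R ^+ 2 * (p ^+ j * Fsh m.+1 p)
            + j%:R * j.-1%:R * (p ^+ j.-2 * Fsh m p))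
  (fun p => p ^+ j * dFsh m p - j%:R * (p ^+ j.-1 * Fsh m p))
  (- (j%:R * 0 ^+ j.-1 / (2 * m).+1%:R)) 0.
rewrite h1.2 h2.2 sub0r opprK -EFinD => I.
apply: EFin_inj; apply: I.
- by move=> p p0; rewrite mulr_ge0 ?moment_ge0 ?exprn_ge0.
- by move=> p p0; rewrite addr_ge0 // mulr_ge0 ?moment_ge0 ?exprn_ge0 // mulr_ge0.
- by move=> p p0; apply: cM; exact: continuous_moment.
- by move=> p p0; apply: continuousD; apply: cM; exact: continuous_moment.
- move=> p p0.
  have d1 := is_derive_mul (is_derive_exp j (is_derive_id p 1)) (is_derive_dFsh m p0).
  have d2 := is_derive_mul (is_derive_exp j.-1 (is_derive_id p 1)) (is_derive_Fsh m p0).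
  have d3 := is_derive_mul (is_derive_cst (j%:R : R) p 1) d2.
  apply: (is_derive_eq (is_deriveB d1 d3)); rewrite !fctE; ring.
- rewrite -[- _]add0r -[X in X - _](mulr0 (0 ^+ j)) -[j%:R * _ / _]mulrA.
  have cx n : (p ^+ n : R) @[p --> 0^'+] --> (0 ^+ n : R).
    by apply: cvg_at_right_filter; exact: continuous_exprn.
  apply: cvgB; first by apply: cvgM; [exact: cx|exact: cvg_at0_dFsh].
  apply: cvgM; first exact: cvg_cst.
  by apply: cvgM; [exact: cx|exact: cvg_at0_Fsh].
- rewrite [X in _ --> X](_ : 0 = 0 - j%:R * 0 :> R); last by rewrite mulr0 subr0.
  apply: cvgB; first exact: cvgy_dFsh.
  by apply: cvgM; [exact: cvg_cst|exact: cvgy_Fsh].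
Qed.

(** F_0 >= 1/cosh p >= exp(-p), whose integral is 1. *)
Lemma Fsh_moment00_gt0 : 0 < Fsh_moment 0 0.
Proof.
have [_ h] := has_integral_exprn_expRN 0 (ltr01 : 0 < 1 :> R).
have [_ h'] := has_integral_Fsh 0 0.
apply: (@lt_le_trans _ _ (0`!%:R / 1 ^+ 1)); first by rewrite fact0 expr1 divr1.
rewrite -lee_fin -h -h'; apply: ge0_le_integral => //=.
- by move=> p _; rewrite lee_fin mulr_ge0 ?expR_ge0// expr0.
- exact: measurable_int (has_integral_exprn_expRN 0 (ltr01 : 0 < 1 :> R)).1.
- exact: measurable_int (has_integral_Fsh 0 0).1.
move=> p; rewrite in_itv/= andbT => p0; rewrite lee_fin !expr0 !mul1r mulN1r.
have /andP[+ _] := Fsh_bounds 0 p0; rewrite muln0 !mul1r => Fp; apply: le_trans Fp.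
rewrite expRN lef_pV2 ?posrE ?expR_gt0 //; last by apply: lt_le_trans (ch_ge1 _).
have : expR (- p) <= expR p by rewrite ler_expR; lra.
by rewrite /ch; lra.
Qed.

End Fsh_moments.

(** * Series expansion of the moments *)

Section negative_binomial.
Local Open Scope classical_set_scope.
Context {R : realType}.
Implicit Types (M l : nat) (z a : R).

(** The coefficient of z^l in (1 - z)^-M: taking partial sums of the coefficients multiplies a power
    series by 1/(1 - z). *)
Fixpoint nbcoef M l : R :=
  if M is M'.+1 then \sum_(0 <= i < l.+1) nbcoef M' i else (l == 0)%N%:R.

Lemma nbcoef_ge0 M l : 0 <= nbcoef M l.
Proof.
by elim: M l => [|M ih] l /=; [rewrite ler0n|apply: sumr_ge0 => i _; exact: ih].
Qed.

Lemma cvg_nbcoef_series M z : 0 <= z < 1 ->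
  series (fun l => nbcoef M l * z ^+ l) @ \oo --> ((1 - z) ^- M : R).
Proof.
move=> /andP[z0 z1]; have z1' : 0 < 1 - z by rewrite subr_gt0.
elim: M => [|M ih].
  rewrite expr0 invr1 -(cvg_shiftS _ (nbhs (1 : R))) /=.
  rewrite (_ : (fun _ => _) = cst (1 : R)); first exact: cvg_cst.
  apply/funext => n; rewrite /series /= big_nat_recl //= mul1r expr0.
  by rewrite big1 ?addr0 // => i _; rewrite mul0r.
set e := fun L => \sum_(0 <= i < L) nbcoef M i.
have e0 L : 0 <= e L by apply: sumr_ge0 => i _; exact: nbcoef_ge0.
(* Summation by parts. It first bounds the partial sums; the resulting convergence forces the terms
   to 0, and this in turn removes the remainder [e L * z ^+ L]. *)
have E L : (1 - z) * series (fun l => nbcoef M.+1 l * z ^+ l) L =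
    series (fun l => nbcoef M l * z ^+ l) L - e L * z ^+ L.
  elim: L => [|L]; rewrite /series /=.
    by rewrite !big_nil /e big_nil mul0r subr0 mulr0.
  rewrite !big_nat_recr //= mulrDr => ->.
  by rewrite /e big_nat_recr //= exprS; ring.
have cv : cvgn (series (fun l => nbcoef M.+1 l * z ^+ l)).
  apply: nondecreasing_is_cvgn.
    apply/nondecreasing_seqP => n; rewrite /series /= [leRHS]big_nat_recr //= lerDl.
    by rewrite mulr_ge0 ?exprn_ge0 // (nbcoef_ge0 M.+1).
  exists ((1 - z)^-1 * (1 - z) ^- M) => _ [L _ <-].
  rewrite -(ler_pM2l z1') mulrA divff ?gt_eqF // mul1r E.
  rewrite -[leRHS]subr0 lerB ?mulr_ge0 ?exprn_ge0 //.
  rewrite -(cvg_lim (@Rhausdorff R) ih).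
  apply: nondecreasing_cvgn_le; last by apply: cvgP ih.
  apply/nondecreasing_seqP => n; rewrite /series /= [leRHS]big_nat_recr //= lerDl.
  by rewrite mulr_ge0 ?exprn_ge0 // nbcoef_ge0.
have e_cvg : e L * z ^+ L @[L --> \oo] --> (0 : R).
  have h : z * (nbcoef M.+1 l * z ^+ l) @[l --> \oo] --> z * 0.
    by apply: cvgM; [exact: cvg_cst|exact: cvg_series_cvg_0].
  rewrite -(cvg_shiftS _ (nbhs (0 : R))) /=; rewrite mulr0 in h.
  rewrite (_ : (fun _ => _) = (fun l => z * (nbcoef M.+1 l * z ^+ l))) //.
  by apply/funext => l; rewrite exprS /= /e; ring.
rewrite (_ : series _ = fun L => (1 - z)^-1 *
   (series (fun l => nbcoef M l * z ^+ l) L - e L * z ^+ L)); last first.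
  by apply/funext => L; rewrite -E mulKf ?gt_eqF.
rewrite exprS invfM -[(1 - z) ^- M]subr0.
by apply: cvgM; [exact: cvg_cst|apply: cvgB].
Qed.

Lemma nneseries_nbcoef M a z : 0 <= z < 1 ->
  (\sum_(l <oo) (a * (nbcoef M l * z ^+ l))%:E = (a / (1 - z) ^+ M)%:E)%E.
Proof.
move=> z01; have h := @cvg_nbcoef_series M z z01; apply/cvg_lim => //=.
under eq_fun do rewrite sumEFin -mulr_sumr.
apply: cvg_EFin; first exact: nearW.
by apply: cvgM => //; exact: cvg_cst.
Qed.

End negative_binomial.

(** * Expansion of the moments into series of rational numbers *)

Section sh_prim_expansion.
Local Open Scope classical_set_scope.
Context {R : realType}.
Implicit Types (p d N P Q : R) (j m l i : nat).
Notation mu := (@lebesgue_measure R).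

(* [int_0^p cosh (2 d q) dq] *)
Definition ch_prim d p : R :=
  if d == 0 then p else (expR (2 * d * p) - expR (- (2 * d) * p)) / (4 * d).

Lemma is_derive_ch_prim d p : is_derive p 1 (ch_prim d)
  ((expR (2 * d * p) + expR (- (2 * d) * p)) / 2).
Proof.
rewrite /ch_prim; have [->|d0] := eqVneq d 0.
  by rewrite mulr0 oppr0 mul0r expR0 (_ : (1 + 1) / 2 = 1 :> R); [exact: is_derive_id|field].
have h := is_derive_mul (is_deriveB (is_derive_expRM (2 * d) p)
  (is_derive_expRM (- (2 * d)) p)) (is_derive_cst ((4 * d)^-1 : R) p 1).
by apply: (is_derive_eq h); rewrite mulr0 add0r /cst; field.
Qed.

Lemma ch_prim0 d : ch_prim d 0 = 0.
Proof. by rewrite /ch_prim; case: ifP => // _; rewrite !mulr0 subrr mul0r. Qed.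

(** Both sides vanish at 0. Their derivatives agree by the binomial expansion of (2 sinh q)^(2m),
    averaged over q and -q to turn exponentials into hyperbolic cosines. *)
Lemma sh_primE m p :
  4 ^+ m * sh_prim m p = \sum_(i < (2 * m).+1)
    (-1) ^+ i * 'C(2 * m, i)%:R * ch_prim (m%:R - i%:R) p.
Proof.
pose f q := 4 ^+ m * sh_prim m q - \sum_(i < (2 * m).+1)
    (-1) ^+ i * 'C(2 * m, i)%:R * ch_prim (m%:R - i%:R) q.
suff : f p = 0 by move/eqP; rewrite subr_eq0 => /eqP.
have <- : f 0 = 0.
  rewrite /f sh_prim0 mulr0 big1 ?subrr // => i _.
  by rewrite ch_prim0 mulr0.
apply: is_derive_0_is_cst => q.
have h1 := is_derive_mul (is_derive_cst (4 ^+ m : R) q 1) (is_derive_sh_prim m q).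
have h2 : is_derive q 1 (fun q => \sum_(i < (2 * m).+1)
      (-1) ^+ i * 'C(2 * m, i)%:R * ch_prim (m%:R - i%:R) q)
    (\sum_(i < (2 * m).+1) (-1) ^+ i * 'C(2 * m, i)%:R *
      ((expR (2 * (m%:R - i%:R) * q) + expR (- (2 * (m%:R - i%:R)) * q)) / 2)).
  have h (i : 'I_(2 * m).+1) := is_derive_mul
    (is_derive_cst ((-1) ^+ i * 'C(2 * m, i)%:R : R) q 1) (is_derive_ch_prim (m%:R - i%:R) q).
  have := is_derive_sum h; rewrite (_ : \sum_(i < _) _ = fun q => \sum_(i < (2 * m).+1)
      (-1) ^+ i * 'C(2 * m, i)%:R * ch_prim (m%:R - i%:R) q); last first.
    by apply/funext => x; rewrite fct_sumE.
  move=> h'; apply: (is_derive_eq h'); apply: eq_bigr => i _.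
  by rewrite mulr0 addr0.
apply: (is_derive_eq (is_deriveB h1 h2)).
have EB x : \sum_(i < (2 * m).+1) (-1) ^+ i * 'C(2 * m, i)%:R *
    expR (2 * (m%:R - i%:R) * x) = (2 * sh x) ^+ (2 * m) :> R.
  rewrite /sh mulrC divfK // exprBn; apply: eq_bigr => i _.
  have -> : expR (2 * (m%:R - i%:R) * x) = expR x ^+ (2 * m - i) * expR (- x) ^+ i.
    rewrite -!expRM_natl -expRD natrB ?leq_ord // natrM; congr expR; ring.
  by rewrite -[in RHS]mulr_natr; ring.
have EB' : \sum_(i < (2 * m).+1) (-1) ^+ i * 'C(2 * m, i)%:R *
    expR (- (2 * (m%:R - i%:R)) * q) = (2 * sh q) ^+ (2 * m) :> R.
  have := EB (- q); rewrite (_ : sh (- q) = - sh q); last by rewrite /sh opprK; ring.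
  rewrite mulrN exprM sqrrN -exprM => <-.
  by apply: eq_bigr => i _; rewrite mulrN -mulNr.
under eq_bigr do rewrite mulrA mulrDr.
rewrite -mulr_suml big_split /= EB EB' /cst mulr0 addr0 ![(2 * sh q) ^+ _]exprMn ![2 ^+ _]exprM.
by rewrite (_ : 2 ^+ 2 = 4 :> R); [field|ring].
Qed.

(** With k = j + 2 and r = i + 1 this is the sum of P^-r Q^-(k-r) over 1 <= r < k, the form in which
    the cube integrals appear. *)
Definition hsum j P Q : R := \sum_(i < j.+1) P ^- i.+1 * Q ^- (j.+1 - i).

Lemma hsum_sub j P Q : P != 0 -> Q != 0 ->
  (P - Q) * hsum j P Q = Q ^- j.+1 - P ^- j.+1.
Proof.
move=> P0 Q0; rewrite -!exprVn subrXX /hsum /=.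
rewrite (_ : Q^-1 - P^-1 = (P - Q) * (P^-1 * Q^-1)); last by field; rewrite P0 Q0.
rewrite -mulrA; congr (_ * _); rewrite big_distrr /=; apply: eq_bigr => i _.
by rewrite -!exprVn subSn ?leq_ord// !exprS; ring.
Qed.

Lemma hsum_diag j P : hsum j P P = j.+1%:R / P ^+ j.+2.
Proof.
rewrite /hsum (eq_bigr (fun=> P ^- j.+2)); last first.
  by move=> i _; rewrite -invfM -exprD; congr (_ ^- _); have := ltn_ord i; lia.
by rewrite sumr_const card_ord mulr_natl.
Qed.

(** For d != 0 the two exponentials integrate to j! (Q^-(j+1) - P^-(j+1)) / (4d) with P, Q = N + 2d,
    N - 2d. Since 4d = P - Q, this is a divided difference, which [hsum_sub] expands; d = 0 is the
    confluent case [hsum_diag]. *)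
Lemma has_integral_ch_prim j N d : 0 < N - 2 * d -> 0 < N + 2 * d ->
  has_integral mu `]0, +oo[
    (fun p => p ^+ j * expR (- N * p) * ch_prim d p)
    (j`!%:R * hsum j (N + 2 * d) (N - 2 * d)).
Proof.
move=> Q0 P0; rewrite /ch_prim; have [d0|d0] := eqVneq d 0.
  have N0 : 0 < N by move: Q0; rewrite d0 mulr0 subr0.
  rewrite d0 mulr0 addr0 subr0 hsum_diag.
  have := has_integral_exprn_expRN j.+1 N0.
  rewrite factS natrM [_%:R * _]mulrC -mulrA => /eq_has_integral; apply=> // p _.
  by rewrite exprSr mulrAC.
have hQ := has_integral_exprn_expRN j Q0.
have hP := has_integral_exprn_expRN j P0.
have := has_integralD (@measurable_gt0 R) (has_integralZ (@measurable_gt0 R) (4 * d)^-1 hQ)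
                           (has_integralZ (@measurable_gt0 R) (- (4 * d)^-1) hP).
rewrite [X in has_integral _ _ _ X](_ : _ = j`!%:R * hsum j (N + 2 * d) (N - 2 * d)); last first.
  have := @hsum_sub j (N + 2 * d) (N - 2 * d).
  rewrite !gt_eqF // => /(_ isT isT); rewrite (_ : _ - _ = 4 * d); last by ring.
  move=> /(canRL (mulKf _)) -> //; last by rewrite mulf_neq0.
  by ring.
move=> /eq_has_integral; apply => // p _.
rewrite (_ : - (N - 2 * d) * p = - N * p + 2 * d * p); last by ring.
rewrite (_ : - (N + 2 * d) * p = - N * p + - (2 * d) * p); last by ring.
by rewrite !expRD; field.
Qed.

(* Coefficient of [nbcoef (2 * m).+1 l] in the expansion of the moments and of
   the cube integrals. *)
Definition expansion_coef j m l : R := \sum_(i < (2 * m).+1)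
  (-1) ^+ i * 'C(2 * m, i)%:R *
  hsum j (2 * l + 2 * (2 * m - i)).+1%:R (2 * l + 2 * i).+1%:R.

Lemma has_integral_sh_prim j m l :
  has_integral mu `]0, +oo[
    (fun p => p ^+ j * expR (- (2 * l + 2 * m).+1%:R * p) * (4 ^+ m * sh_prim m p))
    (j`!%:R * expansion_coef j m l).
Proof.
set N : R := (2 * l + 2 * m).+1%:R.
have PE (i : 'I_(2 * m).+1) :
    (2 * l + 2 * (2 * m - i)).+1%:R = N + 2 * (m%:R - i%:R).
  have iE : i%:R = 2 * m%:R - (2 * m - i)%:R :> R.
    by rewrite natrB ?leq_ord // natrM opprB addrC subrK.
  by rewrite iE /N; move: (2 * m - i)%N => k; ring.
have QE (i : 'I_(2 * m).+1) : (2 * l + 2 * i).+1%:R = N - 2 * (m%:R - i%:R).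
  by rewrite /N; move: (i : nat) => k; ring.
have h (i : 'I_(2 * m).+1) : has_integral mu `]0, +oo[
    (fun p => (-1) ^+ i * 'C(2 * m, i)%:R *
       (p ^+ j * expR (- N * p) * ch_prim (m%:R - i%:R) p))
    ((-1) ^+ i * 'C(2 * m, i)%:R *
      (j`!%:R * hsum j (2 * l + 2 * (2 * m - i)).+1%:R (2 * l + 2 * i).+1%:R)).
  apply: has_integralZ => //.
  by rewrite PE QE; apply: has_integral_ch_prim; rewrite -?PE -?QE ltr0n.
have := has_integral_sum (@measurable_gt0 R) (index_enum 'I_(2 * m).+1) h.
rewrite (_ : \sum_(i <- _) _ = j`!%:R * expansion_coef j m l); last first.
  by rewrite /expansion_coef big_distrr /=; apply: eq_bigr => i _; ring.
move/eq_has_integral; apply => // p _; rewrite sh_primE big_distrr /=.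
by apply: eq_bigr => i _; ring.
Qed.

(** 1/sinh^(2m+1) is (2 exp(-p))^(2m+1) times a negative binomial series in exp(-2p). Of the
    constant 2^(2m+1) = 2 * 4^m, the power 4^m is used up by [sh_primE] and the 2 remains. *)
Lemma Fsh_moment_series j m :
  ((Fsh_moment j m)%:E = \sum_(l <oo)
    (2 * j`!%:R * (nbcoef (2 * m).+1 l * expansion_coef j m l))%:E)%E.
Proof.
have [_ <-] := @has_integral_Fsh R j m.
pose g l p := nbcoef (2 * m).+1 l * 2 *
  (p ^+ j * expR (- (2 * l + 2 * m).+1%:R * p) * (4 ^+ m * sh_prim m p)).
have hg l : has_integral mu `]0, +oo[ (g l)
    (2 * j`!%:R * (nbcoef (2 * m).+1 l * expansion_coef j m l)).
  have := has_integralZ (@measurable_gt0 R) (nbcoef (2 * m).+1 l * 2) (has_integral_sh_prim j m l).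
  by rewrite (_ : _ * (_ * _) = 2 * j`!%:R * (nbcoef (2 * m).+1 l * expansion_coef j m l)) //; ring.
transitivity (\int[mu]_(p in `]0%R, +oo[) (\sum_(l <oo) (g l p)%:E))%E.
  apply: eq_integral => p; rewrite inE /= in_itv/= andbT => p0.
  have z01 : 0 <= expR (- (2 * p)) < 1.
    by rewrite expR_ge0 expR_lt1 oppr_lt0 mulr_gt0.
  have -> : (\sum_(l <oo) (g l p)%:E = \sum_(l <oo) (2 * 4 ^+ m * p ^+ j * sh_prim m p *
      expR (- p) ^+ (2 * m).+1 * (nbcoef (2 * m).+1 l * expR (- (2 * p)) ^+ l))%:E)%E.
    apply: eq_eseriesr => l _; congr EFin; rewrite /g.
    rewrite (_ : expR (- (2 * l + 2 * m).+1%:R * p) =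
        expR (- p) ^+ (2 * m).+1 * expR (- (2 * p)) ^+ l); first by ring.
    by rewrite -!expRM_natl -expRD -!natr1 natrD !natrM; congr expR; ring.
  rewrite nneseries_nbcoef //; congr EFin.
  rewrite /Fsh.
  have -> : sh p = (1 - expR (- (2 * p))) / (2 * expR (- p)).
    have e0 := expR_gt0 (- p).
    rewrite (_ : - (2 * p) = - p + - p); last by ring.
    by rewrite expRD /sh -[expR p]invrK -expRN; field; rewrite gt_eqF.
  rewrite expr_div_n exprMn [2 ^+ (2 * m).+1]exprS [2 ^+ (2 * m)]exprM.
  rewrite (_ : 2 ^+ 2 = 4 :> R); last by ring.
  have : (1 - expR (- (2 * p))) ^+ (2 * m).+1 != 0.
    by rewrite expf_neq0 // gt_eqF // subr_gt0; case/andP: z01.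
  have : expR (- p) ^+ (2 * m).+1 != 0 by rewrite expf_neq0 // gt_eqF // expR_gt0.
  move: (expR (- p) ^+ _) ((1 - _) ^+ _) => a b a0 b0.
  have : (4 ^+ m : R) != 0 by rewrite expf_neq0.
  by move: (4 ^+ m) => c c0; field; rewrite a0 b0 c0.
rewrite integral_nneseries //.
- by apply: eq_eseriesr => l _; have [_ ->] := hg l.
- by move=> l; have [/measurable_int] := hg l.
- move=> l p; rewrite /= in_itv/= andbT => p0; rewrite lee_fin /g.
  have e0 := expR_ge0 (- (2 * l + 2 * m).+1%:R * p).
  have s0 := sh_prim_ge0 m (ltW p0).
  have n0 : 0 <= nbcoef (2 * m).+1 l :> R := nbcoef_ge0 (2 * m).+1 l.
  have p0' := ltW p0.
  by apply: mulr_ge0; apply: mulr_ge0 => //; apply: mulr_ge0 => //; rewrite exprn_ge0.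
Qed.

End sh_prim_expansion.

(** * Integrals over the unit cube *)

Section unit_cube_integral.
Local Open Scope classical_set_scope.
Context {R : realType}.
Implicit Types (k : nat).
Notation rT := (measurableTypeR R).
Notation mu := (@lebesgue_measure R).

Lemma measurable_unit_cube k : measurable (@unit_cube R k).
Proof.
rewrite (_ : @unit_cube R k = \bigcap_(i in [set: 'I_k])
    ((@tnth k rT)^~ i @^-1` `[0, 1])); last first.
  apply/seteqP; split => u h i; first by move=> _; rewrite /= in_itv/= h.
  by have := h i Logic.I; rewrite /= in_itv.
apply: fin_bigcap_measurable => // i _.
by rewrite -[X in measurable X]setTI; exact: measurable_tnth.
Qed.

Lemma unit_cube_tcons k (x : rT) (u : k.-tuple rT) :
  unit_cube (tcons (x, u)) <-> `[0, 1]%classic x /\ unit_cube u.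
Proof.
split=> [h|[x01 h] i].
  split; first by rewrite /= in_itv /=; exact: (h ord0).
  by move=> i; have := h (lift ord0 i); rewrite tnthS.
case: (unliftP ord0 i) => [j ->|->]; first by rewrite tnthS; exact: h.
by move: x01; rewrite /= in_itv.
Qed.

Lemma integral_unit_cubeS k (f : k.+1.-tuple rT -> \bar R) :
  measurable_fun setT f -> (forall u, unit_cube u -> (0 <= f u)%E) ->
  (\int[lebesgue_tuple R k.+1]_(u in @unit_cube R k.+1) f u =
   \int[mu]_(x in `[0%R, 1%R]) \int[lebesgue_tuple R k]_(u in @unit_cube R k)
     f (tcons (x, u)))%E.
Proof.
move=> mf f0.
pose l : {sigma_finite_measure set rT -> \bar R} := @lebesgue_measure R.
pose m : {sigma_finite_measure set (k.-tuple rT) -> \bar R} := lebesgue_tuple R k.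
pose M : {measure set (rT * k.-tuple rT) -> \bar R} := product_measure1 l m.
pose g := f \_ (@unit_cube R k.+1).
have mg : measurable_fun setT g.
  have mc := @measurable_unit_cube k.+1.
  by apply/(measurable_restrictT f mc); exact: measurable_funS mf.
have g0 u : (0 <= g u)%E by apply: erestrict_ge0 => v; exact: f0.
rewrite integral_mkcond.
(* [lebesgue_tuple] at k + 1 unfolds to this push-forward by conversion, so Tonelli applies after
   pulling back along [tcons]. *)
transitivity (\int[pushforward M (@tcons R k)]_u g u)%E.
  by [].
rewrite ge0_integral_pushforward //; last exact: measurable_tcons.
rewrite preimage_setT fubini_tonelli1; last 2 first.
- exact: (measurableT_comp mg (@measurable_tcons R k)).
- by move=> z; exact: g0.
rewrite [RHS]integral_mkcond; apply: eq_integral => x _.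
rewrite /fubini_F patchE; case: ifPn => [|] x01.
  rewrite [RHS]integral_mkcond; apply: eq_integral => u _ /=.
  rewrite /g !patchE; congr (if _ then _ else _).
  apply/idP/idP => [/set_mem/unit_cube_tcons[_ uc]|/set_mem uc]; apply/mem_set => //.
  by apply/unit_cube_tcons; split => //; exact: set_mem x01.
apply: integral0_eq => u _ /=; rewrite /g patchE ifN //.
by apply: contra x01 => /set_mem/unit_cube_tcons[x01 _]; exact/mem_set.
Qed.

Lemma integral01_exprn a :
  (\int[mu]_(x in `[0%R, 1%R]) (x ^+ a)%:E = (a.+1%:R^-1)%:E)%E.
Proof.
have d (x : R) := is_derive_mul (is_derive_exp a.+1 (is_derive_id x 1))
  (is_derive_cst (a.+1%:R^-1 : R) x 1).
rewrite (@continuous_FTC2 _ _ (fun x => x ^+ a.+1 * a.+1%:R^-1)) //.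
- by rewrite expr1n expr0n /= mul0r mul1r sube0.
- by apply: continuous_subspaceT => x; exact: continuous_exprn.
- have c x := is_derive_continuous (d x); split.
  + by move=> x _; have [] := d x.
  + exact/cvg_at_right_filter/c.
  + exact/cvg_at_left_filter/c.
- move=> x _; rewrite derive1E; have [_ ->] := d x.
  by rewrite mulr0 add0r mulr1 /cst mulKf // pnatr_eq0.
Qed.

Lemma measurable_monomial k (a : 'I_k -> nat) :
  measurable_fun setT (fun u : k.-tuple rT => \prod_(i < k) tnth u i ^+ a i).
Proof.
apply: measurable_prod => i _; apply: measurable_funX; exact: measurable_tnth.
Qed.

Lemma monomial_ge0 k (a : 'I_k -> nat) (u : k.-tuple rT) :
  unit_cube u -> 0 <= \prod_(i < k) tnth u i ^+ a i.
Proof.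
by move=> u01; apply: prodr_ge0 => i _; rewrite exprn_ge0 //; case/andP: (u01 i).
Qed.

Lemma integral_monomial k (a : 'I_k -> nat) :
  (\int[lebesgue_tuple R k]_(u in @unit_cube R k)
     (\prod_(i < k) tnth u i ^+ a i)%R%:E = (\prod_(i < k) (a i).+1%:R^-1)%R%:E)%E.
Proof.
elim: k a => [|k ih] a.
  transitivity (\int[@dirac _ (0.-tuple rT) [tuple] R]_(u in @unit_cube R 0) 1)%E.
    by apply: eq_integral => u _; rewrite big_ord0.
  rewrite integral_dirac //; last exact: (@measurable_unit_cube _).
  by rewrite diracE mem_set ?mul1e ?big_ord0 // => -[].
rewrite integral_unit_cubeS; last 2 first.
- by apply/measurable_EFinP; exact: (measurable_monomial a).
- by move=> u u01; rewrite lee_fin monomial_ge0.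
transitivity (\int[mu]_(x in `[0%R, 1%R])
   ((\prod_(i < k) (a (lift ord0 i)).+1%:R^-1)%R%:E * (x ^+ a ord0)%:E))%E.
  apply: eq_integral => x; rewrite inE /= in_itv/= => /andP[x0 _].
  rewrite -ih muleC -ge0_integralZl_EFin ?exprn_ge0 //; last 3 first.
  - exact: (@measurable_unit_cube _).
  - by move=> u u01; rewrite lee_fin monomial_ge0.
  - apply/measurable_EFinP; apply: measurable_funS (measurable_monomial _) => //.
  apply: eq_integral => u _; rewrite -EFinM; congr EFin.
  rewrite big_ord_recl; congr (_ * _).
  by apply: eq_bigr => i _; rewrite tnthS.
rewrite ge0_integralZl_EFin //; last 3 first.
- by move=> x; rewrite /= in_itv/= => /andP[x0 _]; rewrite lee_fin exprn_ge0.
- apply/measurable_EFinP; apply: measurable_funX; exact: measurable_id.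
- by apply: prodr_ge0 => i _; rewrite invr_ge0.
by rewrite integral01_exprn -EFinM big_ord_recl mulrC.
Qed.

Lemma has_integral_monomial k (a : 'I_k -> nat) :
  has_integral (lebesgue_tuple R k) (@unit_cube R k)
    (fun u => \prod_(i < k) tnth u i ^+ a i) (\prod_(i < k) (a i).+1%:R^-1).
Proof.
apply: ge0_has_integral.
- by apply: measurable_funS (measurable_monomial a).
- by move=> u; exact: monomial_ge0.
exact: integral_monomial.
Qed.

End unit_cube_integral.

(** * The cube integrals and their identification with the moments *)

Section cube_kernel.
Local Open Scope classical_set_scope.
Context {R : realType}.
Implicit Types (k r m n l j : nat).
Notation rT := (measurableTypeR R).

Definition cube_left k r (u : k.-tuple rT) : R := \prod_(i < k | (i < r)%N) tnth u i.
Definition cube_right k r (u : k.-tuple rT) : R := \prod_(i < k | (r <= i)%N) tnth u i.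

Definition cube_kernel k r m (u : k.-tuple rT) : R :=
  (cube_left r u ^+ 2 - cube_right r u ^+ 2) ^+ (2 * m) /
  (1 - (cube_left r u * cube_right r u) ^+ 2) ^+ (2 * m).+1.

Lemma cube_left_right k r (u : k.-tuple rT) :
  cube_left r u * cube_right r u = \prod_(i < k) tnth u i.
Proof.
rewrite (bigID (fun i : 'I_k => (i < r)%N)) /=; congr (_ * _).
by apply: eq_bigl => i; rewrite -leqNgt.
Qed.

Lemma measurable_cube_left k r :
  measurable_fun setT (@cube_left k r).
Proof.
rewrite (_ : @cube_left k r = fun u => \prod_(i < k) tnth u i ^+ (i < r)%N).
  exact: (measurable_monomial (fun i : 'I_k => (i < r)%N : nat)).
apply/funext => u; rewrite /cube_left big_mkcond; apply: eq_bigr => i _.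
by case: ifP.
Qed.

Lemma measurable_cube_right k r :
  measurable_fun setT (@cube_right k r).
Proof.
rewrite (_ : @cube_right k r = fun u => \prod_(i < k) tnth u i ^+ (r <= i)%N).
  exact: (measurable_monomial (fun i : 'I_k => (r <= i)%N : nat)).
apply/funext => u; rewrite /cube_right big_mkcond; apply: eq_bigr => i _.
by case: ifP.
Qed.

Lemma measurable_invr : measurable_fun setT (fun x : R => x^-1).
Proof.
rewrite -(setvU [set (0 : R)]); apply/measurable_funU => //.
  exact: measurableC.
split; last exact: measurable_fun_set1.
apply: open_continuous_measurable_fun; first exact/closed_openC/closed_eq.
by move=> x; rewrite inE /= => /eqP x0; exact: inv_continuous.
Qed.

Lemma measurable_cube_kernel k r m :
  measurable_fun setT (@cube_kernel k r m).
Proof.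
have mx := @measurable_cube_left k r; have my := @measurable_cube_right k r.
apply: measurable_funM.
  by apply/measurable_funX/measurable_funB; exact: measurable_funX.
apply: (measurableT_comp measurable_invr).
apply/measurable_funX/measurable_funB => //.
by apply/measurable_funX/measurable_funM.
Qed.

Lemma J_integrandE k r n (u : k.-tuple rT) :
  J_integrand r n u =
  \sum_(m <- index_iota 0 n.+1) (-1) ^+ m * 'C(n, m)%:R * cube_kernel r m u.
Proof.
rewrite /J_integrand /cube_kernel !prodrXl -(cube_left_right r).
rewrite -/(cube_left r u) -/(cube_right r u).
move: (cube_left r u) (cube_right r u) => x y.
set D := 1 - (x * y) ^+ 2; set e := x ^+ 2 - y ^+ 2.
(* At the singular points both sides are 0 because the inverse of 0 is 0, so the identity holds
   everywhere and not only almost everywhere. *)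
rewrite addn1; have [D0|D0] := eqVneq D 0.
  rewrite D0 expr0n /= invr0 mulr0 big1 // => m _.
  by rewrite expr0n /= invr0 !mulr0.
rewrite -exprMn (_ : (1 - x ^+ 4) * (1 - y ^+ 4) = D ^+ 2 - e ^+ 2); last by rewrite /D /e; ring.
rewrite exprBn big_mkord mulr_suml; apply: eq_bigr => m _.
rewrite -mulr_natr -!exprM.
have -> : (2 * n).+1 = (2 * (n - m) + (2 * m).+1)%N by have := ltn_ord m; lia.
rewrite [D ^+ (_ + _)]exprD.
have h a : D ^+ a != 0 by rewrite expf_neq0.
move: (D ^+ (2 * (n - m))) (h (2 * (n - m))%N) (D ^+ (2 * m).+1) (h (2 * m).+1).
by move=> a a0 b b0; field; rewrite a0 b0.
Qed.

Lemma prod_const_lt k r (c : R) : (r <= k)%N -> c != 0 ->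
  \prod_(i < k | (i < r)%N) c = c ^+ r /\
  \prod_(i < k | ~~ (i < r)%N) c = c ^+ (k - r).
Proof.
move=> rk c0; have h : \prod_(i < k | (i < r)%N) c = c ^+ r.
  rewrite (_ : \prod_(i < k | (i < r)%N) c = \prod_(i < r) c).
    by rewrite prodr_const card_ord.
  by rewrite (big_ord_widen _ (fun=> c) rk).
split=> //; apply: (mulfI (expf_neq0 r c0)).
rewrite -exprD subnKC // -{1}h -[in RHS](card_ord k) -prodr_const.
by rewrite [RHS](bigID (fun i : 'I_k => (i < r)%N)).
Qed.

Lemma has_integral_left_right k r a b : (r <= k)%N ->
  has_integral (lebesgue_tuple R k) (@unit_cube R k)
    (fun u => cube_left r u ^+ a * cube_right r u ^+ b)
    (a.+1%:R ^- r * b.+1%:R ^- (k - r)).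
Proof.
move=> rk; pose e (i : 'I_k) := if (i < r)%N then a else b.
have := @has_integral_monomial R k e.
rewrite [X in has_integral _ _ _ X](_ : _ = a.+1%:R ^- r * b.+1%:R ^- (k - r)); last first.
  have inv0 (c : nat) : c.+1%:R^-1 != 0 :> R by rewrite invr_eq0 pnatr_eq0.
  rewrite (bigID (fun i : 'I_k => (i < r)%N)) /= -!exprVn.
  have [<- _] := prod_const_lt rk (inv0 a).
  have [_ <-] := prod_const_lt rk (inv0 b).
  congr (_ * _); first by apply: eq_bigr => i; rewrite /e => ->.
  by apply: eq_bigr => i; rewrite /e => /negbTE ->.
move=> h; apply: (eq_has_integral (@measurable_unit_cube R k) _ h) => u _.
rewrite (bigID (fun i : 'I_k => (i < r)%N)) /= -!prodrXl; congr (_ * _).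
  by apply: eq_bigr => i; rewrite /e => ->.
under [RHS]eq_bigl do rewrite leqNgt.
by apply: eq_bigr => i; rewrite /e => /negbTE ->.
Qed.

Definition cube_coef k r m l : R := \sum_(i < (2 * m).+1)
  (-1) ^+ i * 'C(2 * m, i)%:R *
  ((2 * l + 2 * (2 * m - i)).+1%:R ^- r * (2 * l + 2 * i).+1%:R ^- (k - r)).

Lemma has_integral_kernel_term k r m l : (r <= k)%N ->
  has_integral (lebesgue_tuple R k) (@unit_cube R k)
    (fun u => (cube_left r u ^+ 2 - cube_right r u ^+ 2) ^+ (2 * m) *
              ((cube_left r u * cube_right r u) ^+ 2) ^+ l)
    (cube_coef k r m l).
Proof.
move=> rk; have mc := @measurable_unit_cube R k.
have := has_integral_sum mc (index_enum 'I_(2 * m).+1) (fun i => has_integralZ mc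
  ((-1) ^+ i * 'C(2 * m, i)%:R)
  (@has_integral_left_right k r (2 * l + 2 * (2 * m - i)) (2 * l + 2 * i) rk)).
move=> h; apply: (eq_has_integral (@measurable_unit_cube R k) _ h) => u _.
rewrite exprBn mulr_suml; apply: eq_bigr => i _.
rewrite -mulr_natr -!exprM [(_ * _) ^+ (2 * l)]exprMn !exprD; ring.
Qed.

Lemma cube_left_right_lt1 k r (u : k.+1.-tuple rT) : unit_cube u ->
  tnth u ord0 != 1 -> 0 <= (cube_left r u * cube_right r u) ^+ 2 < 1.
Proof.
move=> u01 u1; have u0 i : 0 <= tnth u i by case/andP: (u01 i).
have ul i : tnth u i <= 1 by case/andP: (u01 i).
rewrite exprn_ge0 /=; last by rewrite cube_left_right prodr_ge0.
rewrite cube_left_right big_ord_recl exprn_ilt1 //.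
  by rewrite mulr_ge0 // prodr_ge0.
apply: (@le_lt_trans _ _ (tnth u ord0)).
  by rewrite ler_piMr // prodr_ile1 // => i _; rewrite u0 ul.
by rewrite lt_neqAle u1 ul.
Qed.

(** The series for the kernel can fail only where all coordinates are 1. The larger face is
    discarded instead, being visibly contained in a box with a side of measure 0. *)
Lemma unit_cube_face_null k :
  (lebesgue_tuple R k.+1).-negligible
    [set u | unit_cube u /\ tnth u ord0 = 1].
Proof.
pose A (i : 'I_k.+1) : set rT := if i == ord0 then [set 1] else `[0, 1].
have mA i : measurable (A i).
  by rewrite /A; case: ifP => _; [exact: measurable_set1|exact: measurable_itv].
exists [set u : k.+1.-tuple rT | forall i, A i (tnth u i)]; split.
- rewrite (_ : [set _ | _] =
      \bigcap_(i in [set: 'I_k.+1]) ((@tnth k.+1 rT)^~ i @^-1` A i)).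
    apply: fin_bigcap_measurable => // i _.
    by rewrite -[X in measurable X]setTI; exact: measurable_tnth.
  by apply/seteqP; split => t /= tA i => [_|]; exact: tA.
- by rewrite lebesgue_tuple_box // big_ord_recl /A eqxx lebesgue_measure_set1 mul0e.
- move=> u /= [u01 u1] i; rewrite /A; case: eqP => [->//|_].
  by rewrite /= in_itv /= u01.
Qed.

Lemma cube_kernel_ge0 k r m (u : k.-tuple rT) : unit_cube u ->
  0 <= cube_kernel r m u.
Proof.
move=> u01; have u0 i : 0 <= tnth u i by case/andP: (u01 i).
have ul i : tnth u i <= 1 by case/andP: (u01 i).
apply: divr_ge0; first by rewrite exprM exprn_ge0 // sqr_ge0.
rewrite exprn_ge0 // subr_ge0 cube_left_right exprn_ile1 ?prodr_ge0 //.
by rewrite prodr_ile1 // => i _; rewrite u0 ul.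
Qed.

Lemma integral_cube_kernel k r m : (r <= k.+1)%N ->
  (\int[lebesgue_tuple R k.+1]_(u in @unit_cube R k.+1) (cube_kernel r m u)%:E =
   \sum_(l <oo) (nbcoef (2 * m).+1 l * cube_coef k.+1 r m l)%:E)%E.
Proof.
move=> rk; have mc := @measurable_unit_cube R k.+1.
pose g l (u : k.+1.-tuple rT) := nbcoef (2 * m).+1 l *
  ((cube_left r u ^+ 2 - cube_right r u ^+ 2) ^+ (2 * m) *
              ((cube_left r u * cube_right r u) ^+ 2) ^+ l).
have hg l := has_integralZ mc (nbcoef (2 * m).+1 l) (has_integral_kernel_term m l rk).
have g0 l u : unit_cube u -> (0 <= (g l u)%:E)%E.
  move=> u01; rewrite lee_fin mulr_ge0 ?nbcoef_ge0 // mulr_ge0 //.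
    by rewrite exprM exprn_ge0 // sqr_ge0.
  by rewrite exprn_ge0 // sqr_ge0.
have mg l : measurable_fun (@unit_cube R k.+1) (fun u => (g l u)%:E).
  by have [/measurable_int] := hg l.
transitivity (\int[lebesgue_tuple R k.+1]_(u in @unit_cube R k.+1)
    \sum_(l <oo) (g l u)%:E)%E.
  apply: ge0_ae_eq_integral => //.
  - apply/measurable_EFinP.
    by apply: measurable_funS (@measurable_cube_kernel k.+1 r m).
  - apply: (@ge0_emeasurable_sum _ _ _ _ (fun l u => (g l u)%:E) xpredT) => [l u u01 _|l _].
      exact: g0.
    exact: mg.
  - by move=> u u01; rewrite lee_fin cube_kernel_ge0.
  - by move=> u u01; apply: nneseries_ge0 => l _ _; exact: g0.
  apply: (negligibleS _ (unit_cube_face_null k)) => u /= /not_implyP[u01 h].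
  split=> //; apply: contrapT => /eqP u1; apply: h.
  rewrite /cube_kernel -nneseries_nbcoef ?cube_left_right_lt1 //.
  by apply: eq_eseriesr => l _; congr EFin; rewrite /g mulrCA.
rewrite integral_nneseries //; apply: eq_eseriesr => l _.
by have [_ ->] := hg l.
Qed.

(** The two expansions meet here: after exchanging the sums, the inner sum over r is [hsum]. *)
Lemma cube_coef_sum j m l :
  \sum_(1 <= r < j.+2) cube_coef j.+2 r m l = expansion_coef j m l.
Proof.
rewrite /cube_coef exchange_big /=; apply: eq_bigr => i _.
rewrite -big_distrr /=; congr (_ * _).
by rewrite big_add1 /= big_mkord; apply: eq_bigr => r _; rewrite subSS.
Qed.

(** Stated in the extended reals, since the cube integrals are not yet known to be finite; their
    finiteness is read off from this identity. *)
Lemma cube_kernel_moment j m :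
  ((2 * j`!%:R)%:E * \sum_(1 <= r < j.+2)
    \int[lebesgue_tuple R j.+2]_(u in @unit_cube R j.+2) (cube_kernel r m u)%:E =
   (Fsh_moment j m)%:E)%E.
Proof.
have I0 r l : (r <= j.+2)%N -> 0 <= nbcoef (2 * m).+1 l * cube_coef j.+2 r m l.
  move=> rj; rewrite mulr_ge0 ?nbcoef_ge0 //.
  have [_ h] := has_integral_kernel_term m l rj.
  rewrite -lee_fin -h; apply: integral_ge0 => u _; rewrite lee_fin mulr_ge0 //.
    by rewrite exprM exprn_ge0 // sqr_ge0.
  by rewrite exprn_ge0 // sqr_ge0.
rewrite (@eq_big_nat _ _ _ _ _ _ (fun r => \sum_(l <oo)
    (nbcoef (2 * m).+1 l * cube_coef j.+2 r m l)%:E)%E); last first.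
  by move=> r /andP[_ rj]; rewrite integral_cube_kernel // ltnW.
rewrite big_nat -nneseries_sum; last first.
  by move=> r l /andP[_ rj]; rewrite lee_fin I0 // ltnW.
rewrite -nneseriesZl; last first.
  by move=> l _; apply: sume_ge0 => r /andP[_ rj]; rewrite lee_fin I0 // ltnW.
rewrite Fsh_moment_series; apply: eq_eseriesr => l _.
by rewrite -big_nat sumEFin -big_distrr /= cube_coef_sum -EFinM.
Qed.

Lemma J_Fsh_moment j n :
  J R j.+2 n = \sum_(0 <= m < n.+1) (-1) ^+ m * 'C(n, m)%:R *
    (2 ^+ j.+1 / j`!%:R * Fsh_moment j m).
Proof.
have mc := @measurable_unit_cube R j.+2.
pose v r m := (\int[lebesgue_tuple R j.+2]_(u in @unit_cube R j.+2) cube_kernel r m u)%R.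
have I0 r m : (0 <= \int[lebesgue_tuple R j.+2]_(u in @unit_cube R j.+2) (cube_kernel r m u)%:E)%E.
  by apply: integral_ge0 => u u01; rewrite lee_fin cube_kernel_ge0.
have jf : 0 < 2 * j`!%:R :> R by rewrite mulr_gt0 // ltr0n fact_gt0.
have S m : (\sum_(1 <= r < j.+2)
    \int[lebesgue_tuple R j.+2]_(u in @unit_cube R j.+2) (cube_kernel r m u)%:E =
    ((2 * j`!%:R)^-1 * Fsh_moment j m)%:E)%E.
  by rewrite EFinM -cube_kernel_moment muleA -EFinM mulVf ?mul1e // gt_eqF.
have hv r m : (1 <= r < j.+2)%N ->
    has_integral (lebesgue_tuple R j.+2) (@unit_cube R j.+2) (cube_kernel r m) (v r m).
  move=> rj; apply: ge0_has_integral.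
  - by apply: measurable_funS (@measurable_cube_kernel j.+2 r m).
  - by move=> u; exact: cube_kernel_ge0.
  rewrite /v /Rintegral fineK // ge0_fin_numE //.
  (* Each integral is a single term of a sum of nonnegative terms whose value [S] is finite. *)
  apply: (@le_lt_trans _ _ ((2 * j`!%:R)^-1 * Fsh_moment j m)%:E); last exact: ltry.
  rewrite -S (bigD1_seq r) ?mem_index_iota ?iota_uniq //= leeDl //.
  by apply: sume_ge0.
have Sv m : \sum_(1 <= r < j.+2) v r m = (2 * j`!%:R)^-1 * Fsh_moment j m.
  apply: EFin_inj; rewrite -S -sumEFin; apply: eq_big_nat => r rj.
  by have [_ ->] := hv r m rj.
rewrite /J (@eq_big_nat _ _ _ _ _ _ (fun r => 2 ^+ j.+2 *
    \sum_(m <- index_iota 0 n.+1) (-1) ^+ m * 'C(n, m)%:R * v r m)); last first.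
  move=> r rj; congr (_ * _).
  have h := has_integral_sum mc (index_iota 0 n.+1) (fun m =>
    has_integralZ mc ((-1) ^+ m * 'C(n, m)%:R) (hv r m rj)).
  have [_ E] := eq_has_integral mc (fun u _ => esym (J_integrandE r n u)) h.
  by rewrite /Rintegral E.
rewrite -big_distrr /= exchange_big /= big_distrr /=; apply: eq_bigr => m _.
rewrite -big_distrr /= Sv exprS.
have jf0 : j`!%:R != 0 :> R by rewrite pnatr_eq0 -lt0n fact_gt0.
by field.
Qed.

(** The Beta integral of t^(c-1) (1-t)^n in algebraic form. By Pascal's rule the sum for n + 1 at c
    is the difference of the sums for n at c and at c + 1. *)
Lemma alternating_binomial_inv n (c : R) : 0 < c ->
  \sum_(0 <= m < n.+1) (-1) ^+ m * 'C(n, m)%:R / (c + m%:R) =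
  n`!%:R / \prod_(i < n.+1) (c + i%:R).
Proof.
elim: n c => [|n ih] c c0.
  by rewrite big_nat1 big_ord1 bin0 fact0 expr0 !mul1r.
have c1 : 0 < c + 1 by rewrite addr_gt0.
have p0 (x : R) k : 0 < x -> 0 < \prod_(i < k) (x + i%:R).
  by move=> x0; apply: prodr_gt0 => i _; rewrite ltr_wpDr.
have -> : \sum_(0 <= m < n.+2) (-1) ^+ m * 'C(n.+1, m)%:R / (c + m%:R) =
    \sum_(0 <= m < n.+1) (-1) ^+ m * 'C(n, m)%:R / (c + m%:R) -
    \sum_(0 <= m < n.+1) (-1) ^+ m * 'C(n, m)%:R / (c + 1 + m%:R).
  rewrite big_nat_recl //= [X in _ = X - _]big_nat_recl //= !bin0 -addrA; congr (_ + _).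
  have -> : \sum_(0 <= i < n) (-1) ^+ i.+1 * 'C(n, i.+1)%:R / (c + i.+1%:R) =
      \sum_(0 <= i < n.+1) (-1) ^+ i.+1 * 'C(n, i.+1)%:R / (c + i.+1%:R) :> R.
    by rewrite [RHS]big_nat_recr //= bin_small // mulr0 mul0r addr0.
  rewrite -sumrB; apply: eq_bigr => i _.
  rewrite binS natrD exprS -[i.+1%:R]natr1 (addrC _ 1) addrA.
  by move: ((c + 1 + i%:R)^-1) => x; ring.
rewrite !ih // big_ord_recl /= addr0.
rewrite [in X in _ = X]big_ord_recl addr0.
rewrite (_ : \prod_(i < n.+1) (c + (lift ord0 i)%:R) = \prod_(i < n.+1) (c + 1 + i%:R)); last first.
  by apply: eq_bigr => i _; rewrite lift0 -natr1 (addrC _ 1) addrA.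
rewrite (_ : \prod_(i < n) (c + (lift ord0 i)%:R) = \prod_(i < n) (c + 1 + i%:R)); last first.
  by apply: eq_bigr => i _; rewrite lift0 -natr1 (addrC _ 1) addrA.
rewrite [in X in _ - _ / X]big_ord_recr [in RHS]big_ord_recr /=.
have := p0 _ n c1; move/lt0r_neq0 => P0.
have cn : c + 1 + n%:R != 0 by rewrite gt_eqF // ltr_wpDr.
rewrite factS natrM.
have -> : n.+1%:R = (c + 1 + n%:R) - c by rewrite -natr1; ring.
move: (\prod_(i < n) _) P0 (c + 1 + n%:R) cn (n`!%:R) => P P0 x x0 f.
by field; rewrite x0 P0 gt_eqF.
Qed.

(** The case c = 1/2 of [alternating_binomial_inv], as (2n+1)!! is 2^(n+1) times the product of the
    1/2 + i for i <= n. *)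
Lemma J1E n : J R 1 n =
  \sum_(0 <= m < n.+1) (-1) ^+ m * 'C(n, m)%:R * (2 * m%:R + 1)^-1.
Proof.
have h : 0 < 2^-1 :> R by rewrite invr_gt0.
transitivity (2^-1 * (n`!%:R / \prod_(i < n.+1) (2^-1 + i%:R)) : R).
  rewrite /J /odd_double_factorial natr_prod.
  rewrite (eq_bigr (fun i : 'I_n.+1 => 2 * (2^-1 + i%:R))); last first.
    by move=> i _; rewrite natrD natrM; field.
  rewrite big_split /= prodr_const card_ord natrM natrX exprS.
  have : \prod_(i < n.+1) (2^-1 + i%:R) != 0 :> R.
    by rewrite gt_eqF // prodr_gt0 // => i _; rewrite ltr_wpDr.
  move: (\prod_(i < n.+1) _) => P P0.
  have t0 : 2 ^+ n != 0 :> R by rewrite expf_neq0.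
  by move: (2 ^+ n) t0 => t t0; field; rewrite P0 t0.
rewrite -alternating_binomial_inv // big_distrr /=; apply: eq_bigr => m _.
by rewrite mulrCA -invfM; congr (_ * _^-1); field.
Qed.

End cube_kernel.

(** * The coefficients B_k(m) and their recurrence *)

Section J_expansion.
Local Open Scope classical_set_scope.
Context {R : realType}.

(** The B_k(m). The values for k < 2 come from the boundary terms of [Fsh_moment_rec], which makes
    [J_diff_rec] uniform in [k]. *)
Definition J_diff (k m : nat) : R :=
  match k with
  | 0 => 0
  | 1 => (2 * m%:R + 1)^-1
  | j.+2 => 2 ^+ j.+1 / j`!%:R * Fsh_moment j m
  end.

Lemma J_diffE k n :
  J R k n = \sum_(0 <= m < n.+1) (-1) ^+ m * 'C(n, m)%:R * J_diff k m.
Proof.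
case: k => [|[|j]]; [|exact: J1E|exact: J_Fsh_moment].
by rewrite big1 // => m _; rewrite mulr0.
Qed.

Lemma J_diff_rec k m :
  m.+1%:R ^+ 2 * J_diff k.+2 m.+1 =
  (m%:R + 1 / 2) ^+ 2 * J_diff k.+2 m - J_diff k m.
Proof.
have c0 : (2 * m).+1%:R != 0 :> R by rewrite pnatr_eq0.
have cE : (2 * m).+1%:R = 2 * m%:R + 1 :> R by rewrite -natr1 natrM.
have dE : (2 * m).+2%:R = 2 * m.+1%:R :> R by rewrite -natrM mulnS.
have hE : m%:R + 1 / 2 = (2 * m).+1%:R / 2 :> R by rewrite cE; field.
have := @Fsh_moment_rec R k m; rewrite dE => h.
(* The factor 4 turns (m + 1/2)^2 and (m + 1)^2 into (2m+1)^2 and (2m+2)^2. It is also the ratio of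
   the powers of 2 normalizing B_(k+2) and B_k when k >= 2. *)
rewrite hE; apply: (mulfI (_ : 4 != 0)) => //.
case: k h => [|[|k]] /=.
- rewrite !mul0r !addr0 fact0 expr1 => h.
  rewrite (_ : 4 * (m.+1%:R ^+ 2 * _) = 2 * ((2 * m.+1%:R) ^+ 2 * Fsh_moment 0 m.+1)); last by field.
  by rewrite -h; field.
- rewrite mulr0 mul0r addr0 expr0 mulr1 -cE (_ : 1`! = 1%N) // => h.
  rewrite (_ : 4 * (m.+1%:R ^+ 2 * _) = 4 * ((2 * m.+1%:R) ^+ 2 * Fsh_moment 1 m.+1)); last by field.
  move: h => /(congr1 (fun x => x - 1 / (2 * m).+1%:R)); rewrite addrK => <-.
  by move: (2 * m).+1%:R c0 => c c0; field.
- rewrite expr0n /= mulr0 mul0r addr0 => h.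
  have f0 : k`!%:R != 0 :> R by rewrite pnatr_eq0 -lt0n fact_gt0.
  have k1 : k.+1%:R != 0 :> R by rewrite pnatr_eq0.
  have k2 : k.+2%:R != 0 :> R by rewrite pnatr_eq0.
  rewrite !factS !natrM !(exprS (2 : R)).
  move: h => /(congr1 (fun x => x - k.+2%:R * k.+1%:R * Fsh_moment k m)); rewrite addrK.
  move: k.+1%:R k1 k.+2%:R k2 m.+1%:R => a a0 b b0 d h.
  rewrite (_ : 4 * (d ^+ 2 * _) = 8 * 2 ^+ k / (b * (a * k`!%:R)) *
    ((2 * d) ^+ 2 * Fsh_moment k.+2 m.+1)); last by field; rewrite f0 a0 b0.
  by rewrite -h; field; rewrite f0 a0 b0.
Qed.

Lemma J_diff20_neq0 : J_diff 2 0 != 0.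
Proof.
rewrite /= fact0 divr1 expr1 mulf_neq0 // gt_eqF //.
exact: Fsh_moment00_gt0.
Qed.

End J_expansion.

Theorem theorem3p9 (R : realType) (Jt : nat -> nat -> R)
    (Jt_def : normalized_J Jt) (s n : nat) (s_ge1 : (1 <= s)%N) :
  Jt (2 * s + 2)%N n =
    \sum_(0 <= k < n.+1)
      (-1) ^+ k * gbinom (- (1 / 2)) k ^+ 2 * 'C(n, k)%:R * Z_even R s k
  /\
  Jt (2 * s + 1)%N n =
    \sum_(0 <= k < n.+1)
      (-1) ^+ k * gbinom (- (1 / 2)) k ^+ 2 * 'C(n, k)%:R * Z_odd R s k.
Proof.
case: s s_ge1 => // s _.
have H := @normalized_of_recurrence R J_diff Jt (fun=> erefl) (fun=> erefl)
  J_diff_rec J_diff20_neq0 J_diffE Jt_def.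
(* [H] pairs the even formula at an index with the odd formula at its successor, so it is used at
   two consecutive indices. *)
by have [+ _] := H s.+1 n; have [_ +] := H s n.
Qed.
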